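(* Let $\mathcal{P}$ be the set of rational functions $P\in\mathbb{C}(x)$ having, for some $m>0$, $m$ simple poles and $m$ simple zeroes such that the $2m$ corresponding points of $\mathbb{C}$ all lie on different orbits under the action of $\mathrm{SL}(2,\mathbb{Z})$ on $\mathbb{P}^1$ by $x\mapsto\frac{ax+b}{cx+d}$ and have no isotropy. For $P\in\mathcal{P}$ let $\theta_P\colon\mathrm{SL}(2,\mathbb{Z})\to\mathrm{Bir}(\mathbb{P}^2)$ be the morphism determined by $$\theta_P(S)=\left(-\frac1x,\ \mathbf{i}y\right),\qquad \theta_P(RS)=\left(\frac{x-1}{x},\ y\cdot\frac{P\left(\frac{x-1}{x}\right)}{P(x)}\right).$$ When $P$ varies in $\mathcal{P}$, the morphisms $\theta_P$ give infinitely many parabolic embeddings up to conjugacy, i.e. the subgroups $\theta_P(\mathrm{SL}(2,\mathbb{Z}))$ form infinitely many conjugacy classes of subgroups of $\mathrm{Bir}(\mathbb{P}^2)$.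
   Context: $\mathbf{i}=\sqrt{-1}$. $\mathrm{Bir}(\mathbb{P}^2)$ is the group of birational self-maps of the complex projective plane, identified with $\mathrm{Bir}(\mathbb{C}^2)$; $(p(x,y),q(x,y))$ denotes the birational map $(x,y)\dashrightarrow(p(x,y),q(x,y))$. $R=\begin{bmatrix}1&1\\0&1\end{bmatrix}$ and $S=\begin{bmatrix}0&1\\-1&0\end{bmatrix}$ generate $\mathrm{SL}(2,\mathbb{Z})$, which has the presentation $\langle R,S\mid S^4=(RS)^3=1,\ S^2(RS)=(RS)S^2\rangle$; the formulas above define a unique homomorphism $\theta_P$. ''No isotropy'' means trivial stabiliser in $\mathrm{PSL}(2,\mathbb{Z})$. For $f\in\mathrm{Bir}(\mathbb{P}^2)$, $\deg f$ is the common degree of the homogeneous polynomials without common factor defining $f$; $f$ is parabolic if $(\deg f^n)_{n}$ grows linearly or quadratically. An embedding $\theta\colon\mathrm{SL}(2,\mathbb{Z})\to\mathrm{Bir}(\mathbb{P}^2)$ is parabolic if each element of infinite order of its image is parabolic. *)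

(* Defs.v *)
From HB Require Import structures.
From mathcomp Require Import all_boot all_order all_algebra.
From mathcomp Require Import fraction complex.
From mathcomp Require Import boolp classical_sets cardinality reals.
From mathcomp Require Import mpoly.

Set Implicit Arguments.
Unset Strict Implicit.
Unset Printing Implicit Defensive.

Import GRing.Theory Num.Theory.
Local Open Scope ring_scope.

Notation ratfun C := {fraction {poly C}}.
Notation ratfun2 C := {fraction {mpoly C[2]}}.

Lemma fracE (A : idomainType) (r : {fraction A}) :
  r = tofrac \n_(repr r) / tofrac \d_(repr r).
Proof.
have nz : \d_(repr r) != 0 by exact: denom_ratioP.
suff <- : r * tofrac \d_(repr r) = tofrac \n_(repr r).
  by rewrite mulfK // tofrac_eq0.
rewrite -{1}[r]reprK; move: (repr r) nz => x nz.
unlock FracField.tofrac; rewrite -[LHS]FracField.pi_mul.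
apply/eqmodP; rewrite /= FracField.equivfE /FracField.mulf.
by rewrite !numden_Ratio ?oner_eq0 ?mulr1 // mulrC.
Qed.

(* [frac_spec phi r s]: some fraction representing r has a denominator that phi
   does not kill, and its image under phi is s. *)
Section FracSpec.

Variables (A : idomainType) (L : fieldType) (phi : {rmorphism A -> L}).

Definition frac_spec (r : {fraction A}) (s : L) : Prop := exists n d : A,
  [/\ phi d != 0, r = tofrac n / tofrac d & s = phi n / phi d].

Lemma frac_spec_neq0 d : phi d != 0 -> tofrac d != 0.
Proof. by rewrite tofrac_eq0; apply: contra_neq => ->; rewrite raddf0. Qed.

Lemma frac_spec0 s : frac_spec 0 s -> s = 0.
Proof.
move=> [n [d [nzd /esym/eqP + ->]]].
rewrite mulf_eq0 invr_eq0 (negPf (frac_spec_neq0 nzd)) orbF tofrac_eq0 => /eqP ->.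
by rewrite raddf0 mul0r.
Qed.

Lemma frac_specC a : frac_spec (tofrac a) (phi a).
Proof. by exists a, 1; rewrite !rmorph1 !divr1 oner_eq0. Qed.

Lemma frac_specD r s r' s' :
  frac_spec r s -> frac_spec r' s' -> frac_spec (r + r') (s + s').
Proof.
move=> [n [d [nzd -> ->]]] [n' [d' [nzd' -> ->]]].
exists (n * d' + n' * d), (d * d'); rewrite rmorphM mulf_neq0 //; split=> //.
  by rewrite addf_div ?frac_spec_neq0 // !(rmorphD, rmorphM).
by rewrite addf_div // rmorphD !rmorphM.
Qed.

Lemma frac_specM r s r' s' :
  frac_spec r s -> frac_spec r' s' -> frac_spec (r * r') (s * s').
Proof.
move=> [n [d [nzd -> ->]]] [n' [d' [nzd' -> ->]]].
exists (n * n'), (d * d'); rewrite !rmorphM mulf_neq0 //.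
by split=> //; rewrite mulf_div.
Qed.

Lemma frac_spec1 : frac_spec 1 1.
Proof. by have := frac_specC 1; rewrite tofrac1 rmorph1. Qed.

Lemma frac_specX r s k : frac_spec r s -> frac_spec (r ^+ k) (s ^+ k).
Proof.
move=> h; elim: k => [|k ih]; last by rewrite !exprS; apply: frac_specM.
by rewrite !expr0; exact: frac_spec1.
Qed.

End FracSpec.

(* u n is of the exact order of n ^ k. *)
Definition grows_as (k : nat) (u : nat -> nat) : Prop :=
  exists c N : nat, forall n, (N <= n)%N ->
    (n ^ k <= c * u n)%N /\ (u n <= c * n ^ k)%N.

Section RationalMaps.

Variable C : fieldType.
Local Notation K := (ratfun2 C).

Definition cst (c : C) : K := tofrac (c%:MP).
HB.instance Definition _ := GRing.RMorphism.copy cst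
  (@tofrac {mpoly C[2]} \o @mpolyC 2 C).

Definition xvar : K := tofrac 'X_(0 : 'I_2).
Definition yvar : K := tofrac 'X_(1 : 'I_2).

(* A pair (p, q) stands for the rational map (x, y) |-> (p(x,y), q(x,y)). *)
Definition ratmap : Type := (K * K)%type.
HB.instance Definition _ := Choice.on ratmap.

Definition idmap : ratmap := (xvar, yvar).

Definition pt (f : ratmap) : 'I_2 -> K := fun i => if i == 0 then f.1 else f.2.

Definition mpoly_at (f : ratmap) : {mpoly C[2]} -> K := mmap cst (pt f).
HB.instance Definition _ f :=
  GRing.RMorphism.copy (mpoly_at f) (mmap cst (pt f)).

(* r(f.1, f.2), computed on a representative of r; the choice is irrelevant
   when f is dominant, in particular when f is birational: see
   [ratfun2_at_frac] and [dominant_compl]. *)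
Definition ratfun2_at (f : ratmap) (r : K) : K :=
  mpoly_at f \n_(repr r) / mpoly_at f \d_(repr r).

Definition ratmap_comp (f g : ratmap) : ratmap :=
  (ratfun2_at g f.1, ratfun2_at g f.2).

Definition dominant (f : ratmap) : Prop :=
  forall p : {mpoly C[2]}, mpoly_at f p = 0 -> p = 0.

Lemma mpoly_atC f c : mpoly_at f c%:MP = cst c.
Proof. exact: mmapC. Qed.

Lemma mpoly_atX f i : mpoly_at f 'X_i = pt f i.
Proof. by rewrite /mpoly_at mmapX mmap1U. Qed.

Lemma mpoly_atD f p q : mpoly_at f (p + q) = mpoly_at f p + mpoly_at f q.
Proof. exact: rmorphD. Qed.

Lemma mpoly_atM f p q : mpoly_at f (p * q) = mpoly_at f p * mpoly_at f q.
Proof. exact: rmorphM. Qed.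

Lemma mpoly_atE f p :
  mpoly_at f p = \sum_(m <- msupp p) cst p@_m * \prod_(i < 2) pt f i ^+ m i.
Proof. by []. Qed.

Lemma mpoly_at_id p : mpoly_at idmap p = tofrac p.
Proof.
rewrite mpoly_atE [in RHS](mpolyE p) rmorph_sum /=; apply: eq_bigr => m _.
rewrite -mul_mpolyC rmorphM /= mpolyXE_id rmorph_prod /=; congr (_ * _).
apply: eq_bigr => i _; rewrite rmorphXn /=; congr (_ ^+ _).
rewrite /pt; case: eqP => [->//|]; case: i => -[|[|//]] h.
  by case; apply: val_inj.
by move=> _; congr (tofrac 'X_(_)); apply: val_inj.
Qed.

Lemma dominant_id : dominant idmap.
Proof. by move=> p /eqP; rewrite mpoly_at_id tofrac_eq0 => /eqP. Qed.

Section Dominant.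
Variable f : ratmap.
Hypothesis f_dom : dominant f.

Lemma dominant_neq0 p : p != 0 -> mpoly_at f p != 0.
Proof. by apply: contra_neq => /f_dom. Qed.

Lemma ratfun2_at_frac (n d : {mpoly C[2]}) : d != 0 ->
  ratfun2_at f (tofrac n / tofrac d) = mpoly_at f n / mpoly_at f d.
Proof.
move=> nzd; rewrite /ratfun2_at; set r := tofrac n / tofrac d.
have nz : \d_(repr r) != 0 by exact: denom_ratioP.
have : n * \d_(repr r) = \n_(repr r) * d.
  apply/eqP; rewrite -tofrac_eq !rmorphM /= -eqr_div ?tofrac_eq0 //.
  by rewrite -fracE.
move/(congr1 (mpoly_at f)); rewrite !rmorphM /= => E.
by apply/eqP; rewrite eqr_div ?dominant_neq0 // E.
Qed.

Lemma ratfun2_at_tofrac n : ratfun2_at f (tofrac n) = mpoly_at f n.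
Proof.
by rewrite -[tofrac n]divr1 -tofrac1 ratfun2_at_frac ?oner_eq0 // rmorph1 divr1.
Qed.

Lemma ratfun2_at_zmod_morphism : zmod_morphism (ratfun2_at f).
Proof.
move=> r s; rewrite (fracE r) (fracE s).
have := denom_ratioP (repr r); have := denom_ratioP (repr s).
move: \n_(repr r) \d_(repr r) \n_(repr s) \d_(repr s) => n d n' d' nzd' nzd.
rewrite -mulNr addf_div ?tofrac_eq0 // -rmorphN -!rmorphM -rmorphD /=.
rewrite !ratfun2_at_frac ?mulf_neq0 //.
by rewrite -mulNr addf_div ?dominant_neq0 // !(rmorphD, rmorphM, rmorphN).
Qed.

Lemma ratfun2_at_monoid_morphism : monoid_morphism (ratfun2_at f).
Proof.
split=> [|r s]; first by rewrite -tofrac1 ratfun2_at_tofrac rmorph1.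
rewrite (fracE r) (fracE s).
have := denom_ratioP (repr r); have := denom_ratioP (repr s).
move: \n_(repr r) \d_(repr r) \n_(repr s) \d_(repr s) => n d n' d' nzd' nzd.
rewrite mulf_div -!rmorphM /= !ratfun2_at_frac ?mulf_neq0 //.
by rewrite !rmorphM mulf_div.
Qed.

Definition ratfun2_at_rmorphism : {rmorphism K -> K} :=
  HB.pack (ratfun2_at f)
    (GRing.isZmodMorphism.Build K K (ratfun2_at f) ratfun2_at_zmod_morphism)
    (GRing.isMonoidMorphism.Build K K (ratfun2_at f)
       ratfun2_at_monoid_morphism).

Lemma ratfun2_at_mpoly g p :
  ratfun2_at f (mpoly_at g p) = mpoly_at (ratmap_comp g f) p.
Proof.
set psi := ratfun2_at_rmorphism.
rewrite -[ratfun2_at f]/(psi : K -> K) !mpoly_atE.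
rewrite rmorph_sum; apply: eq_bigr => m _; rewrite (rmorphM psi) rmorph_prod.
congr (_ * _); first by rewrite /= ratfun2_at_tofrac mpoly_atC.
by apply: eq_bigr => i _; rewrite rmorphXn /= /pt; case: eqP.
Qed.

Lemma ratfun2_at_comp g r :
  ratfun2_at f (ratfun2_at g r) = ratfun2_at (ratmap_comp g f) r.
Proof.
rewrite [ratfun2_at g r]/ratfun2_at.
rewrite -[LHS]/(ratfun2_at_rmorphism _) fmorph_div.
by congr (_ / _); exact: ratfun2_at_mpoly.
Qed.

Lemma ratmap_compA h g :
  ratmap_comp h (ratmap_comp g f) = ratmap_comp (ratmap_comp h g) f.
Proof. by rewrite /ratmap_comp /= !ratfun2_at_comp. Qed.

Lemma ratmap_comp1l : ratmap_comp idmap f = f.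
Proof.
rewrite /ratmap_comp /idmap /= /xvar /yvar !ratfun2_at_tofrac !mpoly_atX.
by case: (f).
Qed.

Lemma dominant_comp g : dominant g -> dominant (ratmap_comp g f).
Proof.
move=> g_dom p; rewrite -ratfun2_at_mpoly.
rewrite -[ratfun2_at f]/(ratfun2_at_rmorphism : K -> K).
by move/eqP; rewrite fmorph_eq0 => /eqP/g_dom.
Qed.

End Dominant.

Lemma ratmap_comp1r f : ratmap_comp f idmap = f.
Proof.
by rewrite /ratmap_comp /ratfun2_at !mpoly_at_id -!fracE; case: f.
Qed.

Local Notation spec f := (frac_spec (mpoly_at f)).

Lemma frac_spec_mpoly f g p : (forall i, spec f (pt g i) (pt idmap i)) ->
  spec f (mpoly_at g p) (mpoly_at idmap p).
Proof.
move=> h; rewrite !mpoly_atE; elim/big_ind2: _ => [|????|m _].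
- by have := frac_specC (mpoly_at f) 0; rewrite tofrac0 raddf0.
- exact: frac_specD.
apply: frac_specM.
  by rewrite -{2}(mpoly_atC f); exact: frac_specC.
elim/big_ind2: _ => [|????|i _]; [exact: frac_spec1|exact: frac_specM|].
apply: frac_specX; exact: h.
Qed.

Lemma frac_spec_at f (r s : K) : s != 0 -> ratfun2_at f r = s -> spec f r s.
Proof.
move=> nzs E; exists \n_(repr r), \d_(repr r).
split; [|exact: fracE|by rewrite -E].
by apply: contra_neq nzs => d0; rewrite -E /ratfun2_at d0 invr0 mulr0.
Qed.

Lemma dominant_compl f g : ratmap_comp f g = idmap -> dominant f.
Proof.
move=> [fg1 fg2] p fp0.
have nzX (i : 'I_2) : tofrac ('X_i : {mpoly C[2]}) != 0.
  by rewrite tofrac_eq0; apply/eqP => /(congr1 (mcoeff U_(i)))/eqP;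
     rewrite mcoeffX eqxx mcoeff0 oner_eq0.
suff : spec g (mpoly_at f p) (mpoly_at idmap p).
  by rewrite fp0 => /frac_spec0/dominant_id.
apply: frac_spec_mpoly => i; rewrite /pt; case: eqP => _;
  by apply: frac_spec_at; rewrite ?nzX.
Qed.

(* The group Bir(C^2): an element is a rational map together with its inverse,
   which it determines ([bir_map_inj]). *)
Definition birational_pair (h : ratmap * ratmap) : bool :=
  (ratmap_comp h.1 h.2 == idmap) && (ratmap_comp h.2 h.1 == idmap).

Definition bir : Type := {h : ratmap * ratmap | birational_pair h}.
HB.instance Definition _ := Choice.on bir.

Definition bir_map (f : bir) : ratmap := (val f).1.
Definition bir_imap (f : bir) : ratmap := (val f).2.

Lemma bir_mapK f : ratmap_comp (bir_map f) (bir_imap f) = idmap.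
Proof. by case/andP: (valP f) => /eqP. Qed.

Lemma bir_imapK f : ratmap_comp (bir_imap f) (bir_map f) = idmap.
Proof. by case/andP: (valP f) => _ /eqP. Qed.

Lemma bir_map_dominant f : dominant (bir_map f).
Proof. exact: dominant_compl (bir_mapK f). Qed.

Lemma bir_imap_dominant f : dominant (bir_imap f).
Proof. exact: dominant_compl (bir_imapK f). Qed.

Lemma bir_map_inj : injective bir_map.
Proof.
move=> f g fg; apply: val_inj.
suff fg' : bir_imap f = bir_imap g.
  by rewrite [LHS]surjective_pairing [RHS]surjective_pairing; congr pair.
rewrite -[LHS]ratmap_comp1r -(bir_mapK g) ratmap_compA; last exact: bir_imap_dominant.
by rewrite -fg bir_imapK ratmap_comp1l //; exact: bir_imap_dominant.
Qed.

Lemma bir_of_inverse (f g : ratmap) :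
  ratmap_comp f g = idmap -> ratmap_comp g f = idmap ->
  exists h : bir, bir_map h = f.
Proof.
move=> fg gf; have fgP : birational_pair (f, g) by rewrite /birational_pair fg gf eqxx.
by exists (exist _ (f, g) fgP).
Qed.

Lemma bir1_subproof : birational_pair (idmap, idmap).
Proof. by rewrite /birational_pair ratmap_comp1r eqxx. Qed.

Definition bir1 : bir := exist _ (idmap, idmap) bir1_subproof.

Lemma birV_subproof f : birational_pair (bir_imap f, bir_map f).
Proof. by rewrite /birational_pair /= bir_mapK bir_imapK eqxx. Qed.

Definition birV f : bir := exist _ (bir_imap f, bir_map f) (birV_subproof f).

Lemma bir_mul_subproof f g :
  birational_pair (ratmap_comp (bir_map f) (bir_map g),
                   ratmap_comp (bir_imap g) (bir_imap f)).
Proof.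
have df := @bir_map_dominant f; have dg := @bir_map_dominant g.
have df' := @bir_imap_dominant f; have dg' := @bir_imap_dominant g.
apply/andP; split; apply/eqP => /=.
  rewrite -ratmap_compA; last by apply: dominant_comp.
  rewrite [ratmap_comp (bir_map g) _](ratmap_compA df') bir_mapK.
  by rewrite (ratmap_comp1l df') bir_mapK.
rewrite -ratmap_compA; last by apply: dominant_comp.
rewrite [ratmap_comp (bir_imap f) _](ratmap_compA dg) bir_imapK.
by rewrite (ratmap_comp1l dg) bir_imapK.
Qed.

Definition bir_mul f g : bir := 
  exist _ (ratmap_comp (bir_map f) (bir_map g),
           ratmap_comp (bir_imap g) (bir_imap f)) (bir_mul_subproof f g).

Lemma bir_mulA : associative bir_mul.
Proof.
move=> f g h; apply: bir_map_inj; apply: ratmap_compA.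
exact: bir_map_dominant.
Qed.

Lemma bir_mul1l : left_id bir1 bir_mul.
Proof.
move=> f; apply: bir_map_inj; apply: ratmap_comp1l; exact: bir_map_dominant.
Qed.

Lemma bir_mul1r : right_id bir1 bir_mul.
Proof. by move=> f; apply: bir_map_inj; apply: ratmap_comp1r. Qed.

Lemma bir_mulVl : left_inverse bir1 birV bir_mul.
Proof. by move=> f; apply: bir_map_inj; apply: bir_imapK. Qed.

Lemma bir_mulVr : right_inverse bir1 birV bir_mul.
Proof. by move=> f; apply: bir_map_inj; apply: bir_mapK. Qed.

HB.instance Definition _ :=
  isGroup.Build bir bir_mulA bir_mul1l bir_mul1r bir_mulVl bir_mulVr.

Lemma bir_map1 : bir_map 1%g = idmap.
Proof. by []. Qed.

Lemma bir_mapM (f g : bir) :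
  bir_map (f * g)%g = ratmap_comp (bir_map f) (bir_map g).
Proof. by []. Qed.

(* The rational function G(x, y, 1). *)
Definition dehom (G : {mpoly C[3]}) : K :=
  mmap cst (fun i : 'I_3 => nth 0 [:: xvar; yvar; 1] i) G.

Definition no_common_factor (F : 'I_3 -> {mpoly C[3]}) : Prop :=
  forall G : {mpoly C[3]}, (forall i, exists H, F i = G * H) ->
  exists2 c : C, c != 0 & G = c%:MP.

(* f is [X : Y : Z] |-> [F 0 : F 1 : F 2] in the chart (x, y) = [x : y : 1],
   with F homogeneous of degree d and without common factor. *)
Definition bir_degree (f : bir) (d : nat) : Prop :=
  exists F : 'I_3 -> {mpoly C[3]},
    [/\ forall i, F i \is d.-homog, no_common_factor F, dehom (F 2) != 0
      & bir_map f = (dehom (F 0) / dehom (F 2), dehom (F 1) / dehom (F 2))].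

Definition parabolic (f : bir) : Prop :=
  exists u : nat -> nat, (forall n, bir_degree (f ^+ n)%g (u n)) /\
    (grows_as 1 u \/ grows_as 2 u).

(* P(r) for P in C(x); as in [ratfun2_at], the choice of a representative of P
   is irrelevant when r is not a constant. *)
Definition ratfun_at (P : ratfun C) (r : K) : K :=
  (map_poly cst \n_(repr P)).[r] / (map_poly cst \d_(repr P)).[r].

End RationalMaps.

Definition mx22 (a b c d : int) : 'M[int]_2 :=
  \matrix_(i, j) if i == 0 then (if j == 0 then a else b)
                 else (if j == 0 then c else d).

Lemma det_mx22 a b c d : \det (mx22 a b c d) = a * d - b * c.
Proof.
rewrite (expand_det_row _ 0) !big_ord_recl big_ord0 addr0 /cofactor !det_mx11.
by rewrite !mxE /= expr0 expr1 mul1r mulN1r mulrN.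
Qed.

Section SL2Z.

Definition SL2Z : Type := {M : 'M[int]_2 | \det M == 1}.
HB.instance Definition _ := SubChoice.on SL2Z.

Lemma SL2Z_det (M : SL2Z) : \det (val M) = 1.
Proof. exact/eqP/(valP M). Qed.

Lemma SL2Z_1_subproof : \det (1%:M : 'M[int]_2) == 1.
Proof. by rewrite det1. Qed.

Lemma SL2Z_mul_subproof (M N : SL2Z) : \det (val M *m val N) == 1.
Proof. by rewrite det_mulmx !SL2Z_det mulr1. Qed.

Lemma SL2Z_inv_subproof (M : SL2Z) : \det (\adj (val M)) == 1.
Proof.
have := congr1 determinant (mul_mx_adj (val M)).
by rewrite det_mulmx SL2Z_det det1 mul1r => ->.
Qed.

Definition SL2Z_1 : SL2Z := exist _ 1%:M SL2Z_1_subproof.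
Definition SL2Z_mul M N : SL2Z :=
  exist _ (val M *m val N) (SL2Z_mul_subproof M N).
Definition SL2Z_inv M : SL2Z := exist _ (\adj (val M)) (SL2Z_inv_subproof M).

Lemma SL2Z_mulA : associative SL2Z_mul.
Proof. by move=> M N L; apply: val_inj; apply: mulmxA. Qed.
Lemma SL2Z_mul1l : left_id SL2Z_1 SL2Z_mul.
Proof. by move=> M; apply: val_inj; apply: mul1mx. Qed.
Lemma SL2Z_mul1r : right_id SL2Z_1 SL2Z_mul.
Proof. by move=> M; apply: val_inj; apply: mulmx1. Qed.
Lemma SL2Z_mulVl : left_inverse SL2Z_1 SL2Z_inv SL2Z_mul.
Proof. by move=> M; apply: val_inj; rewrite /= mul_adj_mx SL2Z_det. Qed.
Lemma SL2Z_mulVr : right_inverse SL2Z_1 SL2Z_inv SL2Z_mul.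
Proof. by move=> M; apply: val_inj; rewrite /= mul_mx_adj SL2Z_det. Qed.

HB.instance Definition _ :=
  isGroup.Build SL2Z SL2Z_mulA SL2Z_mul1l SL2Z_mul1r SL2Z_mulVl SL2Z_mulVr.

Lemma SL2Z_R_subproof : \det (mx22 1 1 0 1) == 1.
Proof. by rewrite det_mx22. Qed.
Lemma SL2Z_S_subproof : \det (mx22 0 1 (-1) 0) == 1.
Proof. by rewrite det_mx22. Qed.
Lemma SL2Z_N_subproof : \det (mx22 (-1) 0 0 (-1)) == 1.
Proof. by rewrite det_mx22. Qed.

Definition SL2Z_R : SL2Z := exist _ (mx22 1 1 0 1) SL2Z_R_subproof.
Definition SL2Z_S : SL2Z := exist _ (mx22 0 1 (-1) 0) SL2Z_S_subproof.
Definition SL2Z_N1 : SL2Z := exist _ (mx22 (-1) 0 0 (-1)) SL2Z_N_subproof.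

End SL2Z.

(* P^1(C) is [option C], [None] being the point at infinity. *)
Section ProjectiveLine.

Variable C : fieldType.

Definition moebius (M : SL2Z) (z : option C) : option C :=
  let e i j : C := (val M i j)%:~R in
  match z with
  | Some x => if e 1 0 * x + e 1 1 == 0 then None
              else Some ((e 0 0 * x + e 0 1) / (e 1 0 * x + e 1 1))
  | None => if e 1 0 == 0 then None else Some (e 0 0 / e 1 0)
  end.

Definition same_orbit (z w : option C) : Prop := exists M, moebius M z = w.

Definition no_isotropy (z : option C) : Prop :=
  forall M, moebius M z = z -> M = 1%g \/ M = SL2Z_N1.

(* Order of vanishing; it does not depend on the representative of P
   ([ratfun_ord_Some], [ratfun_ord_None]). *)
Definition ratfun_ord (P : ratfun C) (z : option C) : int :=
  match z with
  | Some a => (mup a \n_(repr P))%:Z - (mup a \d_(repr P))%:Z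
  | None => (size \d_(repr P))%:Z - (size \n_(repr P))%:Z
  end.

Lemma repr_cross (n d : {poly C}) : n != 0 -> d != 0 ->
  let r := repr (tofrac n / tofrac d) in
  [/\ \n_r != 0, \d_r != 0 & \n_r * d = n * \d_r].
Proof.
move=> nzn nzd r; have nzr : \d_r != 0 by exact: denom_ratioP.
have E : \n_r * d = n * \d_r.
  apply/eqP; rewrite -tofrac_eq !rmorphM -eqr_div ?tofrac_eq0 //.
  by rewrite -fracE.
split=> //; apply: contra_neq nzr => n0; apply/eqP.
by move/eqP: E; rewrite n0 mul0r eq_sym mulf_eq0 (negPf nzn).
Qed.

Lemma ratfun_ord_Some (n d : {poly C}) a : n != 0 -> d != 0 ->
  ratfun_ord (tofrac n / tofrac d) (Some a) = (mup a n)%:Z - (mup a d)%:Z.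
Proof.
move=> nzn nzd; have [nzn' nzd' /(congr1 (mup a))] := repr_cross nzn nzd.
rewrite /ratfun_ord !mupM // => E.
by apply/eqP; rewrite subr_eq addrAC eq_sym subr_eq -!PoszD E.
Qed.

Lemma ratfun_ord_None (n d : {poly C}) : n != 0 -> d != 0 ->
  ratfun_ord (tofrac n / tofrac d) None = (size d)%:Z - (size n)%:Z.
Proof.
move=> nzn nzd; have [nzn' nzd' /(congr1 (fun p : {poly C} => size p))] :=
  repr_cross nzn nzd.
rewrite /ratfun_ord !size_mul // => E.
have {}E : (size \n_(repr (tofrac n / tofrac d)) + size d =
            size n + size \d_(repr (tofrac n / tofrac d)))%N.
  move: E nzn nzn'; rewrite -!size_poly_eq0.
  by case: (size n) => // k; case: (size _) => // l; rewrite !addSn /= => ->.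
apply/eqP; rewrite subr_eq addrAC eq_sym subr_eq -!PoszD.
by rewrite addnC E addnC.
Qed.

(* The 2m points are all the zeros and poles of P on P^1(C). *)
Definition calP (P : ratfun C) : Prop :=
  P != 0 /\ exists (m : nat) (poles zeros : m.-tuple C),
  let pts := poles ++ zeros in
  [/\ (0 < m)%N /\ uniq pts,
      {in poles, forall a, ratfun_ord P (Some a) = - 1},
      {in zeros, forall a, ratfun_ord P (Some a) = 1},
      forall z, z \notin map Some pts -> ratfun_ord P z = 0
    & {in pts &, forall a b, a != b -> ~ same_orbit (Some a) (Some b)} /\
      {in pts, forall a, no_isotropy (Some a)}].

End ProjectiveLine.

Definition morphism_theta (C : numClosedFieldType) (P : ratfun C)
    (theta : SL2Z -> bir C) : Prop :=
  let x := xvar C in let y := yvar C in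
  [/\ {morph theta : M N / (M * N)%g},
      bir_map (theta SL2Z_S) = (- x^-1, cst 'i * y)
    & bir_map (theta (SL2Z_R * SL2Z_S)%g) =
        ((x - 1) / x, y * (ratfun_at P ((x - 1) / x) / ratfun_at P x))].

Definition infinite_order (G : groupType) (g : G) : Prop :=
  forall n : nat, (0 < n)%N -> (g ^+ n)%g <> 1%g.

Definition parabolic_embedding (C : fieldType) (theta : SL2Z -> bir C) : Prop :=
  injective theta /\
  forall f, range theta f -> infinite_order f -> parabolic f.

Definition conj_class (G : groupType) (H : set G) : set (set G) :=
  [set ((fun h => h ^ g)%g @` H)%classic | g in [set: G]]%classic.

(* Main.v *)
From HB Require Import structures.
Require Import Defs.
From mathcomp Require Import all_boot all_order all_algebra.
From mathcomp Require Import zify ring.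
From mathcomp Require Import fraction complex.
From mathcomp Require Import boolp classical_sets cardinality reals.
From mathcomp Require Import mpoly.

Set Implicit Arguments.
Unset Strict Implicit.
Unset Printing Implicit Defensive.

Import Order.TTheory GRing.Theory Num.Theory.
Local Open Scope ring_scope.

(** The maps of [theta_P] preserve the pencil of vertical lines: [theta_P M] is
    [(x, y) |-> (M x, c_M(x) y)], where [c] is a cocycle of SL(2,Z) with values
    in [C(x)^*], determined by [c_S = i] and [c_T = (P o T) / P] for [T = RS].
    As [T] acts by the conjugate of [(T x, y)] by [(x, y P(x))], the relations
    [S^4 = T^3 = 1] and the centrality of [S^2] hold for the two given maps, so
    [theta_P] exists ([SL2Z_presentation]); it is unique because [S] and [T]
    generate. It is injective since the first coordinate determines [M] up to
    sign and [-1] acts by [(x, -y)].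

    Everything else follows from the growth of the height (degree as a
    self-map of the projective line) of [c_(M^n)]. An element of infinite order
    is conjugate, up to sign, to a product of the blocks [T S] and [T^2 S]
    ([inf_order_conj]). For a block product [W = V_1 ... V_L] the cocycle is,
    up to a constant, the product over [j] of
    [P(V_j ... V_L x) / P(S V_(j+1) ... V_L x)]. Up to sign the blocks are
    nonnegative matrices, so no product of blocks is [1] or [S] in PSL(2,Z);
    with the trivial stabilisers and the distinct orbits of the zeros and poles
    of [P], this shows that the [m L] zeros coming from the zeros of [P] are
    distinct and do not cancel ([c_bprod_ht]). Hence the height of [c_(M^n)] lies
    between [m n - O(1)] and [O(n)] ([c_lower], [c_upper]). The degree of a map
    [(M x, c(x) y)] differs from the height of [c] by a bounded amount
    ([jonq_degree]), so all elements of infinite order have linear degree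
    growth.

    Suppose that [g = (u, v)] conjugates [theta_P] to [theta_Q]. The function
    [u] is transformed by Moebius transformations under maps whose cocycles
    have unbounded height, and this forbids two different powers of [y] in [u]
    ([equivariant_vertical]): [u] is a function of [x] alone, and so is the
    first coordinate of the inverse of [g], hence [u] is a Moebius transformation
    ([inverse_ht1]). The function [v] is then an eigenvector, which compares
    [c^P] with a nonzero power of [c^Q] up to bounded height ([eigen_height]).
    Applied to the powers of [R], for which the height of [c^P] is at most
    [2 m_P n], this gives [m_Q <= 2 m_P] ([conj_bound]), so
    functions [P] with [m = 3^j] zeros, [j = 0, 1, 2, ...], give pairwise
    non-conjugate subgroups. Their zeros and poles are taken among the points
    [2i, 3i, 4i, ...], interior to the classical fundamental domain. *)

(** * Words and normal forms in the modular group *)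

Section Words.
Variables (G : groupType) (s t : G).
Local Open Scope group_scope.

Definition letter (b : bool) : G := if b then t else s.
Definition word_val (w : seq bool) : G := foldr (fun b g => letter b * g) 1 w.

Definition tpow (b : bool) : G := if b then t else t * t.
Definition blocks (w : seq bool) : G := foldr (fun b g => tpow b * s * g) 1 w.

(** The tuple [(e, a, w, b)] stands for [s^2e s^a (t^{1 or 2} s)... t^b], the
    reduced words of the amalgam of Z/4 and Z/6 over Z/2. *)
Definition nform : Type := (bool * bool * seq bool * option bool)%type.

Definition nf_val (v : nform) : G := let: (e, a, w, b) := v in
  (if e then s * s else 1) * (if a then s else 1) * blocks w * oapp tpow 1 b.

Lemma blocks_cat v w : blocks (v ++ w) = blocks v * blocks w.
Proof. by elim: v => [|b v ih] /=; rewrite ?mul1g // ih !mulgA. Qed.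

Lemma word_val_cat v w : word_val (v ++ w) = word_val v * word_val w.
Proof. by elim: v => [|b v ih] /=; rewrite ?mul1g // ih !mulgA. Qed.

End Words.

(** Left multiplication by [s], then by [t], on normal forms: it does not depend
    on the group in which words are evaluated. *)
Definition nf_s (v : nform) : nform := let: (e, a, w, b) := v in
  if a then (~~ e, false, w, b) else (e, true, w, b).

Definition nf_t (v : nform) : nform := let: (e, a, w, b) := v in
  if a then (e, false, true :: w, b) else
  match w with
  | [::] => (e, false, [::], match b with None => Some true
                             | Some true => Some false | _ => None end)
  | true :: w' => (e, false, false :: w', b)
  | false :: w' => (e, true, w', b)
  end.

Definition nf_of (w : seq bool) : nform :=
  foldr (fun l v => if l then nf_t v else nf_s v)
        (false, false, [::], None) w.

Section Relations.
Variables (G : groupType) (s t : G).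
Local Open Scope group_scope.
Hypotheses (s4 : s * s * s * s = 1) (t3 : t * t * t = 1)
  (s2t : s * s * t = t * s * s).

Lemma nf_val_of w : word_val s t w = nf_val s t (nf_of w).
Proof.
elim: w => [|l w /= ->]; first by rewrite /= !mul1g.
have ss : s * (s * s) = s * s * s by rewrite mulgA.
have tss : t * (s * s) = s * s * t by rewrite s2t mulgA.
case: (nf_of w) => -[[e a] v] b; case: l => /=; last first.
  by case: a; case: e => /=; rewrite !(mulg1, mul1g, mulgA) ?s4 ?mul1g.
have te : t * (if e then s * s else 1) = (if e then s * s else 1) * t.
  by case: e; rewrite ?mulg1 ?mul1g // mulgA s2t mulgA.
case: a => /=; first by rewrite !mulgA te mulg1.
case: v => [|[] v] /=; rewrite !mulgA te ?mulg1 -!mulgA; congr (_ * _).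
- by case: b => [[]|] /=; rewrite ?(mul1g, mulg1) // ?mulgA ?t3.
- by rewrite !mulgA t3 mul1g.
Qed.

Lemma word_inv (w : seq bool) : exists w', word_val s t w' = (word_val s t w)^-1.
Proof.
elim: w => [|l w [w' ih]]; first by exists [::]; rewrite invg1.
exists (w' ++ if l then [:: true; true] else [:: false; false; false]).
rewrite word_val_cat ih /= invgM; congr (_ * _).
apply/eqP; rewrite -mulg_eq1.
by case: l => /=; rewrite !mulg1 ?mulgA ?s4 ?t3.
Qed.
End Relations.

(** * Matrices of the modular group *)

Section SL2Zentries.

Definition ent (M : SL2Z) (i j : 'I_2) : int := val M i j.

Lemma SL2Z_eqE (M N : SL2Z) : ent M 0 0 = ent N 0 0 -> ent M 0 1 = ent N 0 1 ->
  ent M 1 0 = ent N 1 0 -> ent M 1 1 = ent N 1 1 -> M = N.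
Proof.
move=> h00 h01 h10 h11; apply: val_inj; apply/matrixP => i j.
have H2 (k : 'I_2) : k = 0 \/ k = 1.
  by case: k => -[|[|//]] h; [left|right]; apply: val_inj.
by case: (H2 i) => ->; case: (H2 j) => ->.
Qed.

Lemma entM (M N : SL2Z) i j : ent (M * N)%g i j =
  ent M i 0 * ent N 0 j + ent M i 1 * ent N 1 j.
Proof.
rewrite /ent /= mxE !big_ord_recl big_ord0 addr0.
by congr (_ * val N _ _ + val M _ _ * val N _ _); apply: val_inj.
Qed.

Lemma ent1 : ((ent 1%g 0 0 = 1) * (ent 1%g 0 1 = 0) * (ent 1%g 1 0 = 0) *
  (ent 1%g 1 1 = 1)).
Proof. by rewrite /ent /= !mxE. Qed.

Lemma entS : ((ent SL2Z_S 0 0 = 0) * (ent SL2Z_S 0 1 = 1) *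
  (ent SL2Z_S 1 0 = -1) * (ent SL2Z_S 1 1 = 0)).
Proof. by rewrite /ent /= !mxE. Qed.

Lemma entR : ((ent SL2Z_R 0 0 = 1) * (ent SL2Z_R 0 1 = 1) *
  (ent SL2Z_R 1 0 = 0) * (ent SL2Z_R 1 1 = 1)).
Proof. by rewrite /ent /= !mxE. Qed.

Lemma entN1 : ((ent SL2Z_N1 0 0 = -1) * (ent SL2Z_N1 0 1 = 0) *
  (ent SL2Z_N1 1 0 = 0) * (ent SL2Z_N1 1 1 = -1)).
Proof. by rewrite /ent /= !mxE. Qed.

Lemma ent_det M : ent M 0 0 * ent M 1 1 - ent M 0 1 * ent M 1 0 = 1.
Proof.
rewrite -(SL2Z_det M) (expand_det_row _ 0) !big_ord_recl big_ord0 addr0.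
rewrite /cofactor !det_mx11 !mxE /= expr0 expr1 mul1r mulN1r mulrN /ent.
by congr (_ * val M _ _ - val M _ _ * val M _ _); apply: val_inj.
Qed.

Lemma entV M : ((ent M^-1%g 0 0 = ent M 1 1) * (ent M^-1%g 0 1 = - ent M 0 1) *
  (ent M^-1%g 1 0 = - ent M 1 0) * (ent M^-1%g 1 1 = ent M 0 0)).
Proof.
by do !split; rewrite /ent /= mxE /cofactor det_mx11 !mxE /= ?addn0 ?addn1
  ?expr0 ?expr1 ?mul1r ?mulN1r //; congr (val M _ _) || congr (- val M _ _);
  apply: val_inj.
Qed.

Local Notation S := SL2Z_S.
Local Notation T := (SL2Z_R * SL2Z_S)%g.
Local Notation N1 := SL2Z_N1.

Lemma entT : ((ent T 0 0 = -1) * (ent T 0 1 = 1) *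
  (ent T 1 0 = -1) * (ent T 1 1 = 0)).
Proof. by rewrite !(entS, entR, entM). Qed.

Lemma entTT : ((ent (T * T)%g 0 0 = 0) * (ent (T * T)%g 0 1 = -1) *
  (ent (T * T)%g 1 0 = 1) * (ent (T * T)%g 1 1 = -1)).
Proof. by rewrite !(entT, entM). Qed.

Definition entE := (entS, entT, entTT, entN1, ent1, entV, entR, entM).

Ltac ents := apply: SL2Z_eqE; rewrite !entE.

Lemma SS_N1 : (S * S)%g = N1.
Proof. by ents. Qed.

Lemma S4 : (S * S * S * S)%g = 1%g.
Proof. by ents. Qed.

Lemma T3 : (T * T * T)%g = 1%g.
Proof. by ents. Qed.

Lemma S2T : (S * S * T)%g = (T * S * S)%g.
Proof. by ents. Qed.

Lemma N1C M : (N1 * M)%g = (M * N1)%g.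
Proof. by ents; ring. Qed.

Lemma N1N1 : (N1 * N1)%g = 1%g.
Proof. by ents. Qed.

Lemma entN1M M i j : ent (N1 * M)%g i j = - ent M i j.
Proof.
rewrite entM; have H2 (k : 'I_2) : k = 0 \/ k = 1.
  by case: k => -[|[|//]] h; [left|right]; apply: val_inj.
by case: (H2 i) => ->; rewrite !entN1 ?mul0r ?addr0 ?add0r mulN1r.
Qed.

(** [S] and [T] generate, by the Euclidean algorithm on the first column. *)
Lemma SL2Z_ind (H : SL2Z -> Prop) :
  H 1%g -> (forall M, H M -> H (S * M)%g) -> (forall M, H M -> H (T * M)%g) ->
  forall M, H M.
Proof.
move=> H1 HS HT.
have HN1 M : H M -> H (N1 * M)%g by rewrite -SS_N1 -mulgA => /HS/HS.
have HR M : H M -> H (SL2Z_R * M)%g.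
  have -> : (SL2Z_R * M = N1 * (T * (S * M)))%g by ents; ring.
  by move=> /HS/HT/HN1.
have HRV M : H M -> H (SL2Z_R^-1 * M)%g.
  have -> : (SL2Z_R^-1 * M = S * (T * (T * M)))%g by ents; ring.
  by move=> /HT/HT/HS.
have HSV M : H M -> H (S^-1 * M)%g.
  have -> : (S^-1 * M = N1 * (S * M))%g by ents; ring.
  by move=> /HS/HN1.
have [Rk entRk] : exists Rk : int -> SL2Z, forall k,
    ((ent (Rk k) 0 0 = 1) * (ent (Rk k) 0 1 = k) * (ent (Rk k) 1 0 = 0) *
    (ent (Rk k) 1 1 = 1)).
  have det1 k : \det (mx22 1 k 0 1) == 1 by rewrite det_mx22 mulr0 subr0 mulr1.
  by exists (fun k => Sub (mx22 1 k 0 1) (det1 k)) => k; rewrite /ent /= !mxE.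
have HRk k M : H M -> H (Rk k * M)%g.
  move=> HM; have nat n : H (Rk n%:Z * M)%g /\ H (Rk (- n%:Z) * M)%g.
    elim: n => [|n [ih ih']].
      have -> : Rk 0 = 1%g by apply: SL2Z_eqE; rewrite entRk ent1.
      by rewrite mul1g.
    have -> : (Rk n.+1%:Z * M = SL2Z_R * (Rk n * M))%g.
      by ents; rewrite !entRk; lia.
    have -> : (Rk (- n.+1%:Z) * M = SL2Z_R^-1 * (Rk (- n%:Z) * M))%g.
      by ents; rewrite !entRk; lia.
    by split; [apply: HR | apply: HRV].
  by case: k => k; rewrite ?NegzE; case: (nat k); case: (nat k.+1).
move=> M; have [n] := ubnP (absz (ent M 1 0)); elim: n M => // n ih M ltM.
have [c0 | cn0] := eqVneq (ent M 1 0) 0.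
  have := ent_det M; rewrite c0 mulr0 subr0 => ad.
  have [d1|d1] : ent M 1 1 = 1 \/ ent M 1 1 = -1.
    have : absz (ent M 0 0 * ent M 1 1) = 1%N by rewrite ad.
    by rewrite abszM => /eqP; rewrite muln_eq1 => /andP[_ /eqP]; lia.
  - have -> : (M = Rk (ent M 0 1)%R * 1)%g.
      by move: ad; rewrite d1 => ad; ents; rewrite !entRk ?c0 ?d1; lia.
    by apply: HRk.
  - have -> : (M = N1 * (Rk (- ent M 0 1)%R * 1))%g.
      by move: ad; rewrite d1 => ad; ents; rewrite !entRk ?c0 ?d1; lia.
    by apply/HN1/HRk.
set a := ent M 0 0; set c := ent M 1 0.
have -> : M = (Rk (a %/ c)%Z * (S^-1 * (S * (Rk (- (a %/ c)%Z) * M))))%g.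
  by ents; rewrite !entRk; ring.
apply/HRk/HSV/ih; rewrite !(entS, entRk, entM) -/a -/c.
have := divz_eq a c; have := modz_ge0 a cn0; have := ltz_mod a cn0.
rewrite -/c in ltM; move: (a %/ c)%Z (a %% c)%Z => q r; nia.
Qed.

Lemma SL2Z_word M : exists w, word_val S T w = M.
Proof.
elim/SL2Z_ind: M => [|M [w <-]|M [w <-]]; first by exists [::].
- by exists (false :: w).
- by exists (true :: w).
Qed.

Definition bprod (w : seq bool) : SL2Z := blocks S T w.
Arguments bprod : simpl never.

(** Up to sign, [T S] and [T^2 S] are the unipotent matrices with entries
    [1, 1, 0, 1] and [1, 0, 1, 1]: products of blocks are, up to sign,
    nonnegative matrices, and nontrivial as soon as there is one block. *)
Lemma bprod_pos w : exists e : bool, let x := (-1) ^+ e in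
  [/\ x * ent (bprod w) 0 0 >= 1, x * ent (bprod w) 1 1 >= 1,
      x * ent (bprod w) 0 1 >= 0, x * ent (bprod w) 1 0 >= 0
    & w != [::] -> x * (ent (bprod w) 0 1 + ent (bprod w) 1 0) >= 1].
Proof.
elim: w => [|b w [e /= [h1 h2 h3 h4 _]]]; first by exists false; rewrite !ent1.
have -> : bprod (b :: w) = (tpow T b * S * bprod w)%g by [].
exists (b (+) e); move: h1 h2 h3 h4.
case: b; rewrite /= !entE; move: (ent _ _ _) (ent _ _ _)
  (ent _ _ _) (ent _ _ _) => a c d f; case: e; rewrite /= ?expr0 ?expr1;
  by move=> *; split; lia.
Qed.

Lemma bprod_neqS w : bprod w <> S /\ bprod w <> (N1 * S)%g.
Proof.
have [e [h1 _ _ _ _]] := bprod_pos w.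
by split=> E; move: h1; rewrite E ?entN1M entS; case: e; lia.
Qed.

Lemma bprod_neq1 w : w != [::] -> bprod w <> 1%g /\ bprod w <> N1.
Proof.
move=> wn; have [e [_ _ _ _ /(_ wn)]] := bprod_pos w.
by move=> h; split=> E; move: h; rewrite E ?entN1 ?ent1; case: e; lia.
Qed.

(** A block product equal to some [S^a T^b] up to sign would be nonnegative up
    to sign; of these finitely many matrices, only [1] and [-1] are, and they are
    not products of one block or more. *)
Lemma nf_val1 v : nf_val S T v = 1%g -> v = (false, false, [::], None).
Proof.
case: v => -[[e a] w] b /=; rewrite -/(bprod w) SS_N1 => E.
have {}E : bprod w = ((if a then S else 1)^-1 * (if e then N1 else 1)^-1 *
    (oapp (tpow T) 1 b)^-1)%g.
  rewrite -invgM; move: E; set x := (_ * (if a then _ else _))%g; set y := oapp _ _ _ => E.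
  by apply: (mulgI x); apply: (mulIg y); rewrite E mulVKg mulVg.
have [|wn] := boolP (w == [::]); last first.
  have [x [/= h1 h2 h3 h4 /(_ wn) h5]] := bprod_pos w.
  have /negP[] : ~~ [&& 1 <= (-1) ^+ x * ent (bprod w) 0 0,
      1 <= (-1) ^+ x * ent (bprod w) 1 1, 0 <= (-1) ^+ x * ent (bprod w) 0 1,
      0 <= (-1) ^+ x * ent (bprod w) 1 0 &
      1 <= (-1) ^+ x * (ent (bprod w) 0 1 + ent (bprod w) 1 0)].
    rewrite E; clear; case: a; case: e; case: b => [[]|];
      rewrite /= !entE /=; by case: x.
  by rewrite h1 h2 h3 h4 h5.
move=> /eqP wE; move: E; rewrite wE /bprod /= => E.
have := congr1 (fun M => ent M 0 0) E; have := congr1 (fun M => ent M 0 1) E.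
have := congr1 (fun M => ent M 1 0) E.
by case: a {E}; case: e; case: b => [[]|] //=; rewrite !entE.
Qed.

(** Elements given by the same word of [SL2Z] agree in any group satisfying
    the relations, because the only reduced word with trivial value is the
    empty one. *)
Theorem SL2Z_presentation (G : groupType) (s t : G) :
  (s * s * s * s = 1 -> t * t * t = 1 -> s * s * t = t * s * s ->
   exists theta : SL2Z -> G, [/\ {morph theta : M N / M * N},
     theta S = s & theta T = t])%g.
Proof.
move=> s4 t3 s2t.
have ker w : word_val S T w = 1%g -> word_val s t w = 1%g.
  rewrite (nf_val_of S4 T3 S2T) (nf_val_of s4 t3 s2t).
  by move/nf_val1 => -> /=; rewrite !mul1g.
have wd w w' : word_val S T w = word_val S T w' ->
    word_val s t w = word_val s t w'.
  move=> E; have [v vE] := word_inv S4 T3 w'.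
  have vE' : word_val s t v = (word_val s t w')^-1%g.
    apply/eqP; rewrite -mulg_eq1 -word_val_cat; apply/eqP/ker.
    by rewrite word_val_cat vE mulVg.
  apply/eqP; rewrite -divg_eq1 -vE' -word_val_cat; apply/eqP/ker.
  by rewrite word_val_cat vE E mulgV.
have [wd_of wdP] := choice SL2Z_word.
exists (fun M => word_val s t (wd_of M)); split=> [M N||].
- by rewrite -word_val_cat; apply: wd; rewrite word_val_cat !wdP.
- by rewrite (@wd _ [:: false]) /= ?mulg1 // wdP mulg1.
- by rewrite (@wd _ [:: true]) /= ?mulg1 // wdP mulg1.
Qed.

(** Conjugating cyclically, a reduced word becomes, up to sign, [1], a power of a
    letter, or a nonempty product of blocks. *)
Lemma inf_order_conj M : infinite_order M ->
  exists k e w, w != [::] /\ M = (k * (if e then N1 else 1) * bprod w * k^-1)%g.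
Proof.
pose good X := exists k (e : bool) w,
  w != [::] /\ X = (k * (if e then N1 else 1) * bprod w * k^-1)%g.
(* 12 is a common multiple of the orders of the torsion elements. *)
suff : forall n v, (size v.1.2 < n)%N ->
    good (nf_val S T v) \/ (nf_val S T v ^+ 12 = 1)%g.
  move=> fin inf; have [w wM] := SL2Z_word M; rewrite -wM in inf *.
  rewrite (nf_val_of S4 T3 S2T) in inf *.
  by have [//|E] := fin _ (nf_of w) (ltnSn _); case: (inf 12%N isT E).
pose P X := good X \/ (X ^+ 12 = 1)%g.
have PJ k X Y : X = (k * Y * k^-1)%g -> P Y -> P X.
  move=> -> [[k' [e [w [wn ->]]]]|Y12]; [left|right].
    by exists (k * k')%g, e, w; split=> //; rewrite invgM !mulgA.
  have -> : (k * Y * k^-1 = Y ^ (k^-1))%g by rewrite /conjg invgK mulgA.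
  by rewrite -conjXg Y12 conj1g.
have PN X : P X -> P (N1 * X)%g.
  move=> [[k [e [w [wn ->]]]]|X12]; [left|right].
    exists k, (~~ e), w; split=> //.
    rewrite !mulgA N1C; congr (_ * _ * _)%g; rewrite -mulgA; congr (_ * _)%g.
    by case: e; rewrite ?N1N1 ?mulg1 ?mul1g.
  rewrite expgMn; last exact: N1C.
  by rewrite X12 mulg1 (expgnA _ 2 6) expg2 N1N1 expg1n.
have X4 (X : SL2Z) : (X * X * X * X = 1 -> X ^+ 12 = 1)%g.
  move=> h; rewrite (expgnA _ 4 3) (_ : X ^+ 4 = 1)%g ?expg1n // -h.
  by rewrite !expgSS expg1 !mulgA.
have X3 (X : SL2Z) : (X * X * X = 1 -> X ^+ 12 = 1)%g.
  move=> h; rewrite (expgnA _ 3 4) (_ : X ^+ 3 = 1)%g ?expg1n // -h.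
  by rewrite !expgSS expg1 !mulgA.
have s4 : P S by right; apply/X4/S4.
have t3 b : P (tpow T b).
  right; apply: X3; case: b; first exact: T3.
  by ents.
have p1 : P 1%g by right; exact: expg1n.
elim=> // n ih [[[e a] w] b] /=; rewrite -/(bprod w) ltnS => szw.
suff {e} : P ((if a then S else 1) * bprod w * oapp (tpow T) 1 b)%g.
  by case: e => h; rewrite ?SS_N1 ?mul1g // -!mulgA; apply: PN; rewrite !mulgA.
have Pih e' a' w' b' : (size w' < n)%N -> P (nf_val S T (e', a', w', b')).
  by move=> h; apply: ih.
case: a; last first.
  rewrite mul1g; case: b => [b|] /=; last first.
    rewrite mulg1; case: w szw => // v w _; left; exists 1%g, false, (v :: w).
    by rewrite !mul1g invg1 mulg1.
  case: w szw => [_|v w szw]; first by rewrite mul1g.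
  apply: (PJ (tpow T b)^-1%g _ (tpow T b * tpow T v * S * bprod w)%g).
    by rewrite invgK /bprod /= -!mulgA mulKg.
  have -> : (tpow T b * tpow T v = if b then (if v then tpow T false else 1) else
     if v then 1 else tpow T true)%g.
    by clear -b v; case: b; case: v => //=; ents.
  have st : P (S * bprod w)%g.
    by have := Pih false true w None szw; rewrite /= mul1g mulg1.
  by clear szw; case: b; case: v; rewrite ?mul1g //; left; exists 1%g, false;
     [exists (false :: w)|exists (true :: w)]; rewrite !mul1g invg1 mulg1.
case: b => [b|] /=.
  apply: (PJ S _ (bprod (rcons w b))); last first.
    left; exists 1%g, false, (rcons w b); rewrite !mul1g invg1 mulg1.
    by split=> //; case: (w).
  by rewrite /bprod -cats1 blocks_cat /= !mulg1 !mulgA mulgK.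
rewrite mulg1; case/lastP: w szw => [_|w v szw]; first by rewrite mulg1.
apply: (PJ S _ (N1 * (bprod w * tpow T v))%g).
  by rewrite /bprod -cats1 blocks_cat /= -SS_N1 !mulgA !mulg1; ents; ring.
apply: PN; have := Pih false false w (Some v); rewrite /= !mul1g; apply.
by rewrite size_rcons in szw.
Qed.

End SL2Zentries.

(** * The field of rational functions in one variable *)

Section RationalFunctions.
Variable C : fieldType.
Local Notation E := (ratfun C).

Definition ratC (c : C) : E := tofrac c%:P.
HB.instance Definition _ := GRing.RMorphism.copy ratC
  (@tofrac {poly C} \o @polyC C).

Definition ratX : E := tofrac 'X.

Lemma ratfunP (r : E) : exists n d : {poly C}, d != 0 /\ r = tofrac n / tofrac d.
Proof.
exists \n_(repr r), \d_(repr r); split; last exact: fracE.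
exact: denom_ratioP.
Qed.

Lemma ratfun_coprime (r : E) :
  exists n d : {poly C}, [/\ d != 0, coprimep n d & r = tofrac n / tofrac d].
Proof.
have [n [d [nzd ->]]] := ratfunP r.
have gd : gcdp n d != 0 by rewrite gcdp_eq0 negb_and nzd orbT.
exists (n %/ gcdp n d), (d %/ gcdp n d); split.
- by rewrite dvdp_div_eq0 // dvdp_gcdr.
- by rewrite coprimep_div_gcd // nzd orbT.
apply/eqP; rewrite eqr_div ?tofrac_eq0 // ?dvdp_div_eq0 ?dvdp_gcdr //.
rewrite -!rmorphM /= tofrac_eq; apply/eqP.
rewrite -[X in X * _ = _](divpK (dvdp_gcdl n d)).
by rewrite -[X in _ = _ * X](divpK (dvdp_gcdr n d)) mulrAC mulrA.
Qed.

Lemma ratfun_morph_ext (L : fieldType) (f g : {rmorphism E -> L}) :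
  (forall c, f (ratC c) = g (ratC c)) -> f ratX = g ratX -> f =1 g.
Proof.
move=> fgC fgX r; have [n [d [_ ->]]] := ratfunP r.
have fg p : f (tofrac p) = g (tofrac p).
  elim/poly_ind: p => [|p c ih]; first by rewrite tofrac0 !rmorph0.
  by rewrite tofracD tofracM !rmorphD !rmorphM ih fgX fgC.
by rewrite !fmorph_div !fg.
Qed.

Lemma linear_neq0 (a b : C) : (a != 0) || (b != 0) ->
  ratC a * ratX + ratC b != 0.
Proof.
rewrite /ratC /ratX -tofracM -tofracD tofrac_eq0; apply: contraTN => /eqP p0.
have := congr1 (fun p : {poly C} => p`_0) p0.
have := congr1 (fun p : {poly C} => p`_1) p0.
rewrite !(coefD, coefMX, coefC) /= add0r addr0 ?coef0 => -> ->.
by rewrite eqxx.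
Qed.

Section Evaluation.
Variables (L : fieldType) (j : {rmorphism C -> L}) (t : L).

Definition transcendental_over : Prop :=
  forall p : {poly C}, p != 0 -> (map_poly j p).[t] != 0.

Definition rat_eval (r : E) : L :=
  (map_poly j \n_(repr r)).[t] / (map_poly j \d_(repr r)).[t].

Hypothesis t_tr : transcendental_over.

Lemma rat_eval_frac (n d : {poly C}) : d != 0 ->
  rat_eval (tofrac n / tofrac d) = (map_poly j n).[t] / (map_poly j d).[t].
Proof.
move=> nzd; rewrite /rat_eval; set r := tofrac n / tofrac d.
have nz : \d_(repr r) != 0 by exact: denom_ratioP.
have : n * \d_(repr r) = \n_(repr r) * d.
  apply/eqP; rewrite -tofrac_eq !rmorphM /= -eqr_div ?tofrac_eq0 //.
  by rewrite -fracE.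
move/(congr1 (fun p => (map_poly j p).[t])); rewrite !rmorphM /= !hornerM => e.
by apply/eqP; rewrite eqr_div ?t_tr // e.
Qed.

Lemma rat_eval_tofrac p : rat_eval (tofrac p) = (map_poly j p).[t].
Proof.
by rewrite -[tofrac p]divr1 -tofrac1 rat_eval_frac ?oner_eq0 // rmorph1 hornerC
  divr1.
Qed.

Lemma rat_evalC c : rat_eval (ratC c) = j c.
Proof. by rewrite rat_eval_tofrac map_polyC hornerC. Qed.

Lemma rat_evalX : rat_eval ratX = t.
Proof. by rewrite rat_eval_tofrac map_polyX hornerX. Qed.

Lemma rat_eval_zmod_morphism : zmod_morphism rat_eval.
Proof.
move=> r s; have [n [d [nzd ->]]] := ratfunP r.
have [n' [d' [nzd' ->]]] := ratfunP s.
rewrite -mulNr addf_div ?tofrac_eq0 // -rmorphN -!rmorphM -rmorphD /=.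
rewrite !rat_eval_frac ?mulf_neq0 // -mulNr addf_div ?t_tr //.
by rewrite !(rmorphD, rmorphM, rmorphN) /= !(hornerD, hornerM, hornerN).
Qed.

Lemma rat_eval_monoid_morphism : monoid_morphism rat_eval.
Proof.
split=> [|r s]; first by rewrite -tofrac1 rat_eval_tofrac rmorph1 hornerC.
have [n [d [nzd ->]]] := ratfunP r; have [n' [d' [nzd' ->]]] := ratfunP s.
rewrite mulf_div -!rmorphM /= !rat_eval_frac ?mulf_neq0 //.
by rewrite !rmorphM /= !hornerM mulf_div.
Qed.

Definition rat_eval_rmorphism : {rmorphism E -> L} :=
  HB.pack rat_eval
    (GRing.isZmodMorphism.Build E L rat_eval rat_eval_zmod_morphism)
    (GRing.isMonoidMorphism.Build E L rat_eval rat_eval_monoid_morphism).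

Lemma rat_eval_unique (f : {rmorphism E -> L}) :
  (forall c, f (ratC c) = j c) -> f ratX = t -> f =1 rat_eval.
Proof.
move=> fC fX; rewrite -[rat_eval]/(rat_eval_rmorphism : E -> L).
by apply: ratfun_morph_ext => [c|]; rewrite ?fC ?fX /= ?rat_evalC ?rat_evalX.
Qed.

End Evaluation.

(** * Height of a rational function *)

(** The height of [n / d] in lowest terms is its degree as a self-map of the
    projective line, that is [max (deg n) (deg d)]. *)
Definition ht_le (r : E) (k : nat) : Prop := exists n d : {poly C},
  [/\ d != 0, (size n <= k.+1)%N, (size d <= k.+1)%N & r = tofrac n / tofrac d].

Lemma ht_le_mono r k l : (k <= l)%N -> ht_le r k -> ht_le r l.
Proof.
move=> kl [n [d [nzd sn sd ->]]]; exists n, d; split=> //.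
  exact: leq_trans sn _.
exact: leq_trans sd _.
Qed.

Lemma ht_le_ex r : exists k, ht_le r k.
Proof.
have [n [d [nzd ->]]] := ratfunP r; exists (size n + size d)%N, n, d.
by split=> //; rewrite -addnS ?leq_addr // addnC addSnnS leq_addr.
Qed.

Lemma ht_leC c : ht_le (ratC c) 0.
Proof.
exists c%:P, 1; split; rewrite ?oner_eq0 ?size_polyC ?leq_b1 ?oner_eq0 //.
by rewrite tofrac1 divr1.
Qed.

Lemma size_mul_le (p q : {poly C}) k l : (size p <= k.+1)%N ->
  (size q <= l.+1)%N -> (size (p * q)%R <= (k + l).+1)%N.
Proof.
move=> sp sq; apply: leq_trans (size_polyMleq _ _) _.
by move: sp sq; lia.
Qed.

Lemma ht_leM r s k l : ht_le r k -> ht_le s l -> ht_le (r * s) (k + l).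
Proof.
move=> [n [d [nzd sn sd ->]]] [n' [d' [nzd' sn' sd' ->]]].
exists (n * n'), (d * d'); split; rewrite ?mulf_neq0 ?size_mul_le //.
by rewrite !tofracM mulf_div.
Qed.

Lemma ht_leD r s k l : ht_le r k -> ht_le s l -> ht_le (r + s) (k + l).
Proof.
move=> [n [d [nzd sn sd ->]]] [n' [d' [nzd' sn' sd' ->]]].
exists (n * d' + n' * d), (d * d'); split; rewrite ?mulf_neq0 ?size_mul_le //.
  apply: leq_trans (size_polyD _ _) _; rewrite geq_max size_mul_le //=.
  by rewrite addnC size_mul_le.
by rewrite addf_div ?tofrac_eq0 // !(tofracD, tofracM).
Qed.

Lemma ht_leV r k : ht_le r k -> ht_le r^-1 k.
Proof.
move=> [n [d [nzd sn sd ->]]]; have [->|nzn] := eqVneq n 0.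
  by rewrite tofrac0 mul0r invr0; apply: ht_le_mono (ht_leC 0).
by exists d, n; rewrite invf_div.
Qed.

(** Powers of coprime polynomials are coprime, so lowest terms of [r ^+ m.+1]
    are powers of lowest terms of [r]. *)
Lemma ht_le_root r k m : ht_le (r ^+ m.+1) k -> ht_le r k.
Proof.
move=> [n [d [nzd sn sd rE]]]; have [a [b [nzb cab rE']]] := ratfun_coprime r.
have [a0|nza] := eqVneq a 0.
  by rewrite rE' a0 tofrac0 mul0r; apply: ht_le_mono (ht_leC 0).
have nzn : n != 0.
  apply: contraTneq isT => n0; move: rE; rewrite n0 tofrac0 mul0r rE' => /eqP.
  by rewrite expf_eq0 /= mulf_eq0 invr_eq0 !tofrac_eq0 (negPf nza) (negPf nzb).
have E : a ^+ m.+1 * d = n * b ^+ m.+1.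
  apply/eqP; rewrite -tofrac_eq !tofracM -eqr_div ?tofrac_eq0 ?expf_neq0 //.
  by rewrite !rmorphXn -expr_div_n -rE' rE.
have cabm : coprimep (a ^+ m.+1) (b ^+ m.+1).
  by rewrite coprimep_pexpl // coprimep_pexpr.
have adv : a %| n.
  apply: (@dvdp_trans _ (a ^+ m.+1)); first by rewrite exprS dvdp_mulr.
  by rewrite -(Gauss_dvdpl _ cabm) -E dvdp_mulr.
have bdv : b %| d.
  apply: (@dvdp_trans _ (b ^+ m.+1)); first by rewrite exprS dvdp_mulr.
  by rewrite coprimep_sym in cabm; rewrite -(Gauss_dvdpr _ cabm) E dvdp_mull.
exists a, b; split=> //.
  exact: leq_trans (dvdp_leq nzn adv) sn.
exact: leq_trans (dvdp_leq nzd bdv) sd.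
Qed.

(** The homogenization of degree [k] of [p], evaluated at [(N, D)]. *)
Definition hom_eval (k : nat) (N D p : {poly C}) : {poly C} :=
  \sum_(i < k.+1) p`_i *: (N ^+ i * D ^+ (k - i)).

Lemma hom_evalE k (N D p : {poly C}) : D != 0 -> (size p <= k.+1)%N ->
  (map_poly ratC p).[tofrac N / tofrac D] =
    tofrac (hom_eval k N D p) / tofrac D ^+ k.
Proof.
move=> D0 sp; apply: (@mulIf _ (tofrac D ^+ k)); first by rewrite expf_neq0 ?tofrac_eq0.
rewrite divfK ?expf_neq0 ?tofrac_eq0 // (horner_coef_wide _ (n := k.+1)); last first.
  by rewrite size_map_poly.
rewrite mulr_suml rmorph_sum; apply: eq_bigr => i _ /=.
rewrite coef_map /= -mul_polyC !tofracM !rmorphXn /= -mulrA; congr (_ * _).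
have -> : tofrac D ^+ k = tofrac D ^+ i * tofrac D ^+ (k - i).
  by rewrite -exprD subnKC // (ltnSE (ltn_ord i)).
by rewrite mulrA -exprMn divfK ?tofrac_eq0.
Qed.

Lemma size_hom_eval k (N D p : {poly C}) : (size N <= 2)%N -> (size D <= 2)%N ->
  (size (hom_eval k N D p) <= k.+1)%N.
Proof.
move=> sN sD; apply: leq_trans (size_sum _ _ _) _; apply/bigmax_leqP => i _.
apply: leq_trans (size_scale_leq _ _) _; rewrite -[k in X in (_ <= X)%N](subnKC
  (ltnSE (ltn_ord i))).
have sX (q : {poly C}) m : (size q <= 2)%N -> (size (q ^+ m) <= m.+1)%N.
  move=> sq; apply: leq_trans (size_poly_exp_leq _ _) _; rewrite ltnS.
  by rewrite -[X in (_ <= X)%N]mul1n leq_mul2r; apply/orP; right; lia.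
by apply: size_mul_le; apply: sX.
Qed.

(** A substitution of height one does not increase heights: clear denominators
    homogeneously. *)
Lemma ht_le_eval (h : E) r k : transcendental_over ratC h -> ht_le h 1 ->
  ht_le r k -> ht_le (rat_eval ratC h r) k.
Proof.
move=> h_tr [N [D [nzD sN sD hE]]] [n [d [nzd sn sd ->]]].
have := h_tr _ nzd; rewrite hE (hom_evalE _ nzD sd) mulf_eq0 tofrac_eq0 negb_or => /andP[nzh _].
exists (hom_eval k N D n), (hom_eval k N D d); split; rewrite ?size_hom_eval //.
rewrite -hE (rat_eval_frac h_tr n nzd) hE (hom_evalE _ nzD sn) (hom_evalE _ nzD sd).
by rewrite invf_div mulrA divfK // expf_neq0 ?tofrac_eq0.
Qed.

End RationalFunctions.

(** * Moebius transformations *)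

Section MoebiusField.
Variable L : fieldType.
Implicit Types (M N : SL2Z) (t : L).

Definition mnum M t : L := (ent M 0 0)%:~R * t + (ent M 0 1)%:~R.
Definition mden M t : L := (ent M 1 0)%:~R * t + (ent M 1 1)%:~R.
Definition mob M t : L := mnum M t / mden M t.

(** The orbit of [t] avoids infinity. *)
Definition off_poles t : Prop := forall M, mden M t != 0.

Lemma mnumM M N t : mden N t != 0 ->
  mnum (M * N)%g t = mnum M (mob N t) * mden N t.
Proof.
rewrite /mnum /mob /mden => nz; rewrite !entM !(rmorphD, rmorphM) /=.
by rewrite /mnum; field.
Qed.

Lemma mdenM M N t : mden N t != 0 ->
  mden (M * N)%g t = mden M (mob N t) * mden N t.
Proof.
rewrite /mob /mden => nz; rewrite !entM !(rmorphD, rmorphM) /=.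
by rewrite /mnum; field.
Qed.

Lemma mobM M N t : mden N t != 0 -> mob (M * N)%g t = mob M (mob N t).
Proof. by move=> nz; rewrite {1}/mob mnumM // mdenM // -mulf_div divff ?mulr1. Qed.

Lemma mob1 t : mob 1%g t = t.
Proof. by rewrite /mob /mnum /mden !ent1 mul1r mul0r add0r addr0 divr1. Qed.

Lemma mobN1 M t : mob (SL2Z_N1 * M)%g t = mob M t.
Proof.
by rewrite /mob /mnum /mden !entN1M !rmorphN !mulNr -!opprD invrN mulrNN.
Qed.

Lemma mobK M t : off_poles t -> mob M^-1%g (mob M t) = t.
Proof. by move=> gt; rewrite -mobM ?gt // mulVg mob1. Qed.

Lemma mobVK M t : off_poles t -> mob M (mob M^-1%g t) = t.
Proof. by move=> gt; rewrite -mobM ?gt // mulgV mob1. Qed.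

End MoebiusField.

Lemma mob_rmorph (L L' : fieldType) (f : {rmorphism L -> L'}) M t :
  f (mob M t) = mob M (f t).
Proof. by rewrite fmorph_div /mnum /mden !(rmorphD, rmorphM) /= !rmorph_int. Qed.

Lemma ent_row1_neq0 M : (ent M 1 0 != 0) || (ent M 1 1 != 0).
Proof.
have := ent_det M; apply: contra_eqT; rewrite negb_or !negbK => /andP[/eqP-> /eqP->].
by rewrite !mulr0 subr0 eq_sym oner_eq0.
Qed.

Section MoebiusRatfun.
Variable C : numClosedFieldType.
Local Notation E := (ratfun C).

Lemma transcendental_of_nonconst (L : fieldType) (j : {rmorphism C -> L}) t :
  (forall a, j a != t) -> transcendental_over j t.
Proof.
move=> tn p nzp; have [r ->] := closed_field_poly_normal p.
rewrite map_polyZ hornerZ mulf_neq0 ?fmorph_eq0 ?lead_coef_eq0 //.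
rewrite rmorph_prod horner_prod prodf_seq_neq0; apply/allP => a _ /=.
by rewrite rmorphB /= map_polyX map_polyC hornerXsubC subr_eq0 eq_sym tn.
Qed.

Lemma off_poles_nonconst (L : fieldType) (j : {rmorphism C -> L}) t :
  (forall a, j a != t) -> off_poles t.
Proof.
move=> tn M; apply: contraT; rewrite negbK => /eqP d0.
have [c0|cn0] := eqVneq (ent M 1 0) 0.
  have := ent_row1_neq0 M; rewrite c0 eqxx /= => dn0; move/eqP: d0.
  rewrite /mden c0 mul0r add0r -(rmorph_int j) fmorph_eq0 intr_eq0.
  by rewrite (negPf dn0).
have := tn (- (ent M 1 1)%:~R / (ent M 1 0)%:~R); rewrite fmorph_div rmorphN.
rewrite !rmorph_int => /eqP[]; have nz : (ent M 1 0)%:~R != 0 :> L.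
  by rewrite -(rmorph_int j) fmorph_eq0 intr_eq0.
by apply: (mulIf nz); rewrite divfK //; move/eqP: d0; rewrite addr_eq0 => /eqP <-; rewrite mulrC.
Qed.

Lemma mob_nonconst (L : fieldType) (j : {rmorphism C -> L}) N t :
  (forall a, j a != t) -> forall a, j a != mob N t.
Proof.
move=> tn a; apply: contra_neq (tn (mob N^-1%g a)) => E.
by rewrite mob_rmorph E mobK //; apply: off_poles_nonconst tn.
Qed.

Lemma ratX_nonconst a : ratC a != ratX C.
Proof.
rewrite /ratC /ratX tofrac_eq; apply/eqP => /(congr1 (size : {poly C} -> nat)).
by rewrite size_polyC size_polyX; case: (a != 0).
Qed.

Lemma mob_tr N : transcendental_over (@ratC C) (mob N (ratX C)).
Proof. exact/transcendental_of_nonconst/mob_nonconst/ratX_nonconst. Qed.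

Lemma ratX_off_poles : off_poles (ratX C).
Proof. exact: off_poles_nonconst ratX_nonconst. Qed.

(** The right action of the modular group on rational functions, by
    substitution. *)
Definition act N : {rmorphism E -> E} := rat_eval_rmorphism (mob_tr N).
Arguments act : simpl never.

Lemma actC N c : act N (ratC c) = ratC c.
Proof. exact: rat_evalC (mob_tr N) c. Qed.

Lemma actX N : act N (ratX C) = mob N (ratX C).
Proof. exact: rat_evalX (mob_tr N). Qed.

Lemma actM M N r : act N (act M r) = act (M * N)%g r.
Proof.
rewrite -[LHS]/((act N \o act M) r); apply: ratfun_morph_ext => [c|];
  rewrite -[LHS]/(act N (act M _)).
  by rewrite !actC.
by rewrite !actX mob_rmorph actX mobM // ratX_off_poles.
Qed.

Lemma act1 r : act 1%g r = r.
Proof.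
rewrite -[RHS]/((idfun : {rmorphism E -> E}) r).
by apply: ratfun_morph_ext => [c|]; rewrite -[LHS]/(act _ _) -[RHS]/(id _)
  ?actC // actX mob1.
Qed.

Lemma act_mul N r s : act N (r * s) = act N r * act N s.
Proof. exact: (rmorphM (act N)). Qed.

Lemma act_neq0 N r : r != 0 -> act N r != 0.
Proof. by rewrite fmorph_eq0. Qed.

Lemma act_one N : act N 1 = 1.
Proof. exact: (rmorph1 (act N)). Qed.

Lemma ht_le_lin (a b c d : C) : (c != 0) || (d != 0) ->
  ht_le ((ratC a * ratX C + ratC b) / (ratC c * ratX C + ratC d)) 1.
Proof.
have sl (x y : C) : (size (x%:P * 'X + y%:P)%R <= 2)%N.
  by rewrite size_MXaddC; case: ifP => // _; rewrite size_polyC; case: (x != 0).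
move=> cd; exists (a%:P * 'X + b%:P), (c%:P * 'X + d%:P); split=> //.
  by have := linear_neq0 cd; rewrite /ratC /ratX -tofracM -tofracD tofrac_eq0.
by rewrite !tofracD !tofracM.
Qed.

Lemma ht_le_act N r k : ht_le r k -> ht_le (act N r) k.
Proof.
apply: ht_le_eval (mob_tr N) _; rewrite /mob /mnum /mden.
have /(_ C) int2 (K : numClosedFieldType) z : z%:~R = @ratC K z%:~R by rewrite rmorph_int.
by rewrite !int2; apply: ht_le_lin; rewrite !intr_eq0 ent_row1_neq0.
Qed.

(** * Divisors supported on given points *)

Definition prodX (s : seq C) : {poly C} := \prod_(z <- s) ('X - z%:P).

Lemma prodX_neq0 s : prodX s != 0.
Proof. by rewrite monic_neq0 ?monic_prod_XsubC. Qed.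

(** Common points of [Z] and [Q] are allowed: whether they cancel is left to
    [ht_le_has_div]. *)
Definition has_div (r : E) (Z Q : seq C) : Prop := exists2 k : C,
  k != 0 & r = ratC k * (tofrac (prodX Z) / tofrac (prodX Q)).

Lemma has_divC c : c != 0 -> has_div (ratC c) [::] [::].
Proof. by exists c => //; rewrite /prodX big_nil tofrac1 divr1 mulr1. Qed.

Lemma has_divM r s Z Q Z' Q' : has_div r Z Q -> has_div s Z' Q' ->
  has_div (r * s) (Z ++ Z') (Q ++ Q').
Proof.
move=> [k k0 ->] [k' k0' ->]; exists (k * k'); first by rewrite mulf_neq0.
rewrite rmorphM /= /prodX !big_cat /= !tofracM invfM.
ring.
Qed.

Lemma has_divV r Z Q : has_div r Z Q -> has_div r^-1 Q Z.
Proof.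
by move=> [k k0 ->]; exists k^-1; rewrite ?invr_eq0 // invfM invf_div fmorphV.
Qed.

(** A factor [X - a] becomes [X - M^-1 a] up to a constant and one denominator of
    the Moebius map; for a quotient of as many factors as divisors, the
    denominators cancel. *)
Lemma act_prodX M (s : seq C) : (forall a, a \in s -> off_poles a) ->
  exists2 k : C, k != 0 & act M (tofrac (prodX s)) =
    ratC k * tofrac (prodX (map (mob M^-1%g) s)) / mden M (ratX C) ^+ size s.
Proof.
elim: s => [|a s ih] sg.
  by exists 1; rewrite ?oner_eq0 // /prodX !big_nil tofrac1 !rmorph1 divr1 mulr1.
have [|k k0 E] := ih; first by move=> b bs; apply: sg; rewrite inE bs orbT.
have ga : mden M^-1%g a != 0 by apply: sg; rewrite inE eqxx.
exists (mden M^-1%g a * k); first by rewrite mulf_neq0.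
rewrite [map _ _]/= /prodX !big_cons -!/(prodX _) !tofracM rmorphM E.
have -> : act M (tofrac ('X - a%:P)) =
    ratC (mden M^-1%g a) * tofrac ('X - (mob M^-1%g a)%:P) / mden M (ratX C).
  rewrite !tofracB rmorphB -/(ratX C) -!/(ratC _) actX actC.
  have k1 : mden M^-1%g a * mob M^-1%g a = mnum M^-1%g a by rewrite mulrC divfK.
  apply: (mulIf (ratX_off_poles M)).
  rewrite [mob M _]/mob mulrBl !divfK ?ratX_off_poles // mulrBr.
  rewrite -[X in _ = _ - X]rmorphM k1 /mden /mnum !entV.
  rewrite !(rmorphD, rmorphM, rmorphN, rmorphB) /= !rmorph_int; ring.
by rewrite exprS rmorphM /= invfM; ring.
Qed.

Lemma has_div_act M r Z Q : size Z = size Q ->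
  (forall a, a \in Z ++ Q -> off_poles a) -> has_div r Z Q ->
  has_div (act M r) (map (mob M^-1%g) Z) (map (mob M^-1%g) Q).
Proof.
move=> sZQ g [k k0 ->].
have [a aZ|kz kz0 Ez] := @act_prodX M Z; first by apply: g; rewrite mem_cat aZ.
have [a aQ|kq kq0 Eq] := @act_prodX M Q; first by apply: g; rewrite mem_cat aQ orbT.
exists (k * (kz / kq)); first by rewrite !mulf_neq0 ?invr_eq0.
rewrite rmorphM fmorph_div actC Ez Eq !rmorphM fmorphV sZQ /=.
have nz : mden M (ratX C) ^+ size Q != 0 by rewrite expf_neq0 ?ratX_off_poles.
by rewrite invf_div [X in _ * X = _]mulrA divfK // invfM; ring.
Qed.

(** A point of [Z] outside [Q] is a root of every numerator of [r]. *)
Lemma ht_le_has_div r Z Q s k : has_div r Z Q -> ht_le r k -> uniq s ->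
  {subset s <= Z} -> (forall a, a \in s -> a \notin Q) -> (size s <= k)%N.
Proof.
move=> [c c0 rE] [n [d [nzd sn _ rE']]] us sZ sQ.
have E : c%:P * prodX Z * d = n * prodX Q.
  apply/eqP; rewrite -tofrac_eq !tofracM -eqr_div ?tofrac_eq0 ?prodX_neq0 //.
  by rewrite -rE' rE mulrA.
have nzn : n != 0.
  apply/eqP => n0; move/eqP: E; rewrite n0 mul0r !mulf_eq0 (negPf nzd).
  by rewrite polyC_eq0 (negPf c0) (negPf (prodX_neq0 Z)).
suff : (size s < size n)%N by move=> h; have := leq_trans h sn.
apply: max_poly_roots us => //; apply/allP => a aS.
have : root (n * prodX Q) a.
  rewrite -E !rootM; apply/orP; left; apply/orP; right.
  by rewrite root_prod_XsubC; apply: sZ.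
by rewrite rootM root_prod_XsubC (negPf (sQ a aS)) orbF.
Qed.

End MoebiusRatfun.
Arguments act {C} N : simpl never.
(* Unification would otherwise unfold a substitution into quotients of
   representatives. *)
Global Opaque act.

(** * Growth of the height along a cocycle *)

Section Cocycle.
Variable C : numClosedFieldType.
Local Notation E := (ratfun C).
Local Notation S := SL2Z_S.
Local Notation T := (SL2Z_R * SL2Z_S)%g.
Local Notation N1 := SL2Z_N1.

(** Distinct points with trivial stabilisers, in distinct orbits that avoid
    infinity. *)
Definition general_position (s : seq C) : Prop :=
  [/\ uniq s, {in s, forall a, off_poles a} &
    {in s &, forall a b M, mob M a = b -> a = b /\ (M = 1%g \/ M = N1)}].

Lemma has_div_perm (r : E) Z Q Z' Q' : perm_eq Z Z' -> perm_eq Q Q' ->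
  has_div r Z Q -> has_div r Z' Q'.
Proof.
move=> zz qq [k k0 ->]; exists k => //.
by rewrite /prodX (perm_big _ zz) (perm_big _ qq).
Qed.

Lemma ht_le_div (r : E) Z Q m : has_div r Z Q -> (size Z <= m)%N ->
  (size Q <= m)%N -> ht_le r m.
Proof.
move=> [k k0 ->] sZ sQ; exists (k%:P * prodX Z), (prodX Q).
split; rewrite ?prodX_neq0 ?size_prod_XsubC //; last by rewrite tofracM mulrA.
by rewrite mul_polyC size_scale // size_prod_XsubC.
Qed.

(** The zeros of the cocycle over the block product of [w] are the preimages of
    the zeros of [P] by [zero_mats w] and of the poles of [P] by [pole_mats w];
    for its poles, the roles of [P] and [P^-1] are exchanged. *)
Fixpoint zero_mats (w : seq bool) : seq SL2Z :=
  if w is _ :: w' then bprod w :: zero_mats w' else [::].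
Fixpoint pole_mats (w : seq bool) : seq SL2Z :=
  if w is _ :: w' then (S * bprod w')%g :: pole_mats w' else [::].

Lemma zero_matsP w M : M \in zero_mats w ->
  exists v, bprod w = (bprod v * M)%g.
Proof.
elim: w => // b w ih; rewrite inE => /orP[/eqP ->|/ih [v vE]].
  by exists [::]; rewrite mul1g.
by exists (b :: v); rewrite -[bprod (b :: w)]/(tpow T b * S * bprod w)%g vE
  -[bprod (b :: v)]/(tpow T b * S * bprod v)%g !mulgA.
Qed.

Lemma pole_matsP w M : M \in pole_mats w ->
  exists b v, (bprod w = bprod (b :: v) * S^-1 * M)%g.
Proof.
elim: w => // b w ih; rewrite inE => /orP[/eqP ->|/ih [b' [v vE]]].
  by exists b, [::]; rewrite /bprod /= mulg1 !mulgA mulgK.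
exists b, (b' :: v); rewrite -[bprod (b :: w)]/(tpow T b * S * bprod w)%g vE.
by rewrite -[bprod (b :: _ :: _)]/(tpow T b * S * bprod (b' :: v))%g !mulgA.
Qed.

Lemma N1_eq (M N : SL2Z) : M = (N1 * N)%g -> N = (N1 * M)%g.
Proof. by move=> ->; rewrite mulgA N1N1 mul1g. Qed.

Lemma zero_mats_head b w M : M \in zero_mats w ->
  bprod (b :: w) <> M /\ bprod (b :: w) <> (N1 * M)%g.
Proof.
move=> /zero_matsP [v vE].
have -> : (bprod (b :: w) = bprod (b :: v) * M)%g.
  by rewrite -[bprod (b :: w)]/(tpow T b * S * bprod w)%g vE
    -[bprod (b :: v)]/(tpow T b * S * bprod v)%g !mulgA.
have [n1 nN] := @bprod_neq1 (b :: v) isT; split=> h.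
  by apply: n1; apply: (mulIg M); rewrite h mul1g.
by apply: nN; apply: (mulIg M); rewrite h.
Qed.

Lemma zero_mats_proj w M N : M \in zero_mats w -> N \in zero_mats w ->
  N = M \/ N = (N1 * M)%g -> N = M.
Proof.
move=> hM hN [//|]; elim: w hM hN => // b w ih.
rewrite !inE => /orP[/eqP ->|hM] /orP[/eqP ->|hN] E //; last exact: ih.
  by have [_ /(_ (N1_eq E))] := zero_mats_head b hN.
by have [_ /(_ E)] := zero_mats_head b hM.
Qed.

Lemma zero_mats_uniq w : uniq (zero_mats w).
Proof.
elim: w => //= b w ->; rewrite andbT; apply/negP => h.
by have [/(_ erefl)] := zero_mats_head b h.
Qed.

Lemma zero_pole_mats w M N : M \in zero_mats w -> N \in pole_mats w ->
  N <> M /\ N <> (N1 * M)%g.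
Proof.
have SV : (S^-1 = N1 * S)%g.
  by apply: (mulIg S); rewrite mulVg -mulgA SS_N1 N1N1.
have cancel (X Y Z : SL2Z) : (X * Z = Y * Z -> X = Y)%g by apply: mulIg.
elim: w => // b w ih; rewrite !inE => /orP[/eqP ->|hM] /orP[/eqP ->|hN].
- have [n1 n2] := bprod_neqS [:: b]; rewrite /bprod /= mulg1 in n1 n2.
  split=> h; [apply: n1|apply: n2; apply: N1_eq]; apply: (cancel _ _ (bprod w)).
    by rewrite h.
  by rewrite h !mulgA.
- have [b' [v vE]] := pole_matsP hN; have [n1 n2] := bprod_neqS (b :: b' :: v).
  have E : (bprod (b :: w) = bprod (b :: b' :: v) * S^-1 * N)%g.
    rewrite -[bprod (b :: w)]/(tpow T b * S * bprod w)%g vE.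
    by rewrite -[bprod (b :: _ :: _)]/(tpow T b * S * bprod (b' :: v))%g !mulgA.
  split=> h; [apply: n1|apply: n2]; apply: (cancel _ _ (S^-1 * N)%g).
    by rewrite mulgA -E -h mulVKg.
  by rewrite mulgA -E (N1_eq h) -[RHS]mulgA mulVKg.
- have [v vE] := zero_matsP hM; have [n1 n2] := bprod_neqS v.
  rewrite vE mulgA; split=> h.
    apply: n2; rewrite -SV; apply: (mulgI S); rewrite mulgV.
    by apply: (cancel _ _ M); rewrite h mul1g.
  apply: n1; apply: (mulgI S); rewrite SS_N1; exact: (cancel _ _ M).
- exact: ih.
Qed.

(** A cocycle with values as on [S] and [T = R S] below describes the action
    of the subgroup on the second coordinate. *)
Variables (P : E) (zs ps : seq C) (m : nat) (c : SL2Z -> E).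
Hypotheses (sz : size zs = m) (sp : size ps = m)
  (gp : general_position (zs ++ ps)) (divP : has_div P zs ps).
Hypotheses (c_neq0 : forall M, c M != 0)
  (cM : forall M N, c (M * N)%g = c N * act N (c M))
  (cS : c S = ratC 'i) (cT : c T = act T P / P).

Lemma c1 : c 1%g = 1.
Proof.
have := cM 1%g 1%g; rewrite mul1g act1 -{1}[c 1%g]mulr1.
by move/(mulfI (c_neq0 _)).
Qed.

Lemma cN1 : c N1 = ratC (-1).
Proof. by rewrite -SS_N1 cM cS actC -rmorphM -expr2 sqrCi. Qed.

Lemma ht_cM M N k l : ht_le (c M) k -> ht_le (c N) l ->
  ht_le (c (M * N)%g) (l + k).
Proof. by move=> hM hN; rewrite cM; apply: ht_leM => //; apply: ht_le_act. Qed.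

Lemma P_neq0 : P != 0.
Proof.
have [k k0 ->] := divP; rewrite !mulf_neq0 ?fmorph_eq0 ?invr_eq0 //;
by rewrite tofrac_eq0 prodX_neq0.
Qed.

Lemma c_tpow b : c (tpow T b) = act (tpow T b) P / P.
Proof.
case: b => //; rewrite /tpow cM cT fmorph_div actM.
by rewrite mulrC mulrA divfK // fmorph_eq0 P_neq0.
Qed.

Lemma c_block b w : c (bprod (b :: w)) =
  c (bprod w) * (ratC 'i * (act (bprod (b :: w)) P / act (S * bprod w)%g P)).
Proof.
rewrite -[bprod (b :: w)]/(tpow T b * S * bprod w)%g cM cM cS c_tpow.
have actD M (x y : E) : act M (x / y) = act M x / act M y by exact: fmorph_div.
by rewrite [act S _]actD actM rmorphM actC actD !actM.
Qed.

Definition pull (L : seq SL2Z) (s : seq C) : seq C :=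
  [seq mob M^-1%g a | M <- L, a <- s].

Lemma c_bprod_div w : has_div (c (bprod w))
  (pull (zero_mats w) zs ++ pull (pole_mats w) ps)
  (pull (zero_mats w) ps ++ pull (pole_mats w) zs).
Proof.
elim: w => [|b w ih]; first by rewrite c1 -(rmorph1 (@ratC C)); apply/has_divC/oner_neq0.
have [_ g _] := gp.
have dP M : has_div (act M P) (map (mob M^-1%g) zs) (map (mob M^-1%g) ps).
  by apply: has_div_act => //; rewrite sz sp.
have nzi : 'i != 0 :> C by exact: neq0Ci.
rewrite c_block; have := has_divM ih (has_divM (has_divC nzi)
  (has_divM (dP (bprod (b :: w))) (has_divV (dP (S * bprod w)%g)))).
by apply: has_div_perm; rewrite /pull /=; apply/permP => x; rewrite !count_cat;
  by rewrite addnACA [X in (X + _)%N]addnC [X in (_ + X)%N]addnC.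
Qed.

(** No cancellation occurs on the orbit of a zero of [P]: a block product is
    never [1] nor [S] up to sign, and stabilisers are trivial. *)
Lemma c_bprod_ht w k : ht_le (c (bprod w)) k -> (m * size w <= k)%N.
Proof.
move=> hk; have [us g orb] := gp.
have uz : uniq zs by move: us; rewrite cat_uniq => /and3P[].
have mobV (M N : SL2Z) a b : a \in zs ++ ps -> b \in zs ++ ps ->
    mob M^-1%g a = mob N^-1%g b -> a = b /\ (N = M \/ N = (N1 * M)%g).
  move=> ha hb /(congr1 (mob N)); rewrite (mobVK _ (g b hb)) -mobM; last exact: g.
  case/(orb _ _ ha hb) => -> [] E; split=> //; [left|right].
    by apply: (mulIg M^-1%g); rewrite E mulgV.
  by apply: (mulIg M^-1%g); rewrite E mulgK.
have <- : size (pull (zero_mats w) zs) = (m * size w)%N.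
  rewrite size_allpairs sz mulnC; congr (_ * _)%N.
  by elim: w {hk} => //= b w ->.
apply: (ht_le_has_div (c_bprod_div w) hk).
- apply: allpairs_uniq => //; first exact: zero_mats_uniq.
  move=> [M a] [N b] /allpairsP[[M' a'] /= [hM ha [-> ->]]].
  move=> /allpairsP[[N' b'] /= [hN hb [-> ->]]] E.
  case: (mobV _ _ _ _ _ _ E); rewrite ?mem_cat ?ha ?hb // => -> h.
  by rewrite (zero_mats_proj hM hN h).
- by move=> a ha; rewrite mem_cat ha.
move=> _ /allpairsP[[M a] /= [hM ha ->]]; rewrite mem_cat; apply/negP => /orP[].
  move=> /allpairsP[[N b] /= [hN hb /mobV]]; rewrite !mem_cat ha hb orbT.
  case=> // ab _; move: us; rewrite cat_uniq => /and3P[_ /hasPn /(_ b hb)].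
  by rewrite /= -ab ha.
move=> /allpairsP[[N b] /= [hN hb /mobV]]; rewrite !mem_cat ha hb.
by case=> // _; have [n1 n2] := zero_pole_mats hM hN; case.
Qed.

Lemma ht_sign (e : bool) : ht_le (c (if e then N1 else 1%g)) 0.
Proof. by case: e; rewrite ?cN1 ?c1 -?(rmorph1 (@ratC C)); exact: ht_leC. Qed.

(** Conjugation to a block product changes heights by a constant. *)
Lemma c_lower M : infinite_order M -> exists B, forall n k,
  ht_le (c (M ^+ n)%g) k -> (m * n <= k + B)%N.
Proof.
move=> /inf_order_conj [g [e [w [wn ->]]]].
have [a ha] := ht_le_ex (c g); have [b hb] := ht_le_ex (c g^-1%g).
exists (a + b)%N => n k; set Z := if e then N1 else _.
have [e' E] : exists e' : bool, (bprod (flatten (nseq n w)) =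
    (if e' then N1 else 1) * (g^-1 * (g * Z * bprod w * g^-1) ^+ n * g))%g.
  have ZC x : (Z * x = x * Z)%g by rewrite /Z; case: (e); rewrite ?mul1g ?mulg1 ?N1C.
  have ZZ : (Z * Z = 1)%g by rewrite /Z; case: (e); rewrite ?mul1g ?N1N1.
  have [e' eE] : exists e' : bool, (Z ^+ n = if e' then N1 else 1)%g.
    elim: n => [|n [e' eE]]; first by exists false.
    exists (e (+) e'); rewrite expgS eE /Z.
    by case: (e); case: (e'); rewrite /= ?mul1g ?mulg1 ?N1N1.
  exists e'; rewrite -eE; have -> x : (g^-1 * x ^+ n * g = (x ^ g) ^+ n)%g.
    by rewrite -conjXg /conjg mulgA.
  rewrite /conjg !mulgA mulVg mul1g mulgVK expgMn; last exact: ZC.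
  have ZZn : (Z ^+ n * Z ^+ n = 1)%g.
    by rewrite -expgMn // ZZ expg1n.
  rewrite mulgA ZZn mul1g; elim: (n) => // l ih.
  by rewrite expgS -ih /= /bprod blocks_cat.
move=> hk; have : ht_le (c (bprod (flatten (nseq n w)))) (k + (a + b)).
  rewrite E; have := ht_cM (ht_sign e') (ht_cM (ht_cM hb hk) ha).
  by apply: ht_le_mono; lia.
move/c_bprod_ht; apply: leq_trans; rewrite leq_mul2l size_flatten /shape map_nseq.
rewrite sumn_nseq; case: (w) wn => // x w' _; rewrite /= mulSn leq_addr.
by rewrite orbT.
Qed.

Lemma c_upper M a n : ht_le (c M) a -> ht_le (c (M ^+ n)%g) (a * n).
Proof.
move=> ha; elim: n => [|n ih]; first by rewrite muln0; exact: (ht_sign false).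
by rewrite expgSr mulnS; apply: ht_cM.
Qed.

Lemma ht_cR : ht_le (c SL2Z_R) (2 * m).
Proof.
have -> : (SL2Z_R = N1 * bprod [:: true])%g.
  apply: N1_eq; rewrite -SS_N1 /bprod /= mulg1.
  by rewrite -[(SL2Z_R * S * S)%g]mulgA SS_N1 N1C.
have hb : ht_le (c (bprod [:: true])) (2 * m).
  apply: ht_le_div (c_bprod_div _) _ _; rewrite size_cat !size_allpairs /= !mul1n sz sp;
  by rewrite addnn mul2n.
by apply: ht_le_mono (ht_cM (ht_sign true) hb); rewrite addn0.
Qed.

End Cocycle.

(** * Maps preserving the pencil of vertical lines *)

Section Jonquieres.
Variable C : numClosedFieldType.
Local Notation E := (ratfun C).
Local Notation K := (ratfun2 C).
Local Notation x := (xvar C).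
Local Notation y := (yvar C).

Lemma mpoly_morph_ext (L : nzRingType) (f g : {rmorphism {mpoly C[2]} -> L}) :
  (forall a, f a%:MP = g a%:MP) -> f 'X_0 = g 'X_0 -> f 'X_1 = g 'X_1 -> f =1 g.
Proof.
move=> fgC fg0 fg1 p; rewrite (mpolyE p) !rmorph_sum; apply: eq_bigr => m _.
rewrite -mul_mpolyC !rmorphM /= mpolyXE_id !rmorph_prod fgC; congr (_ * _).
apply: eq_bigr => i _; rewrite !rmorphXn; congr (_ ^+ _).
have [->|->] // : i = 0 \/ i = 1.
by case: i => -[|[|//]] h; [left|right]; apply: val_inj.
Qed.

Lemma mpolyX_neqC n (i : 'I_n) a : 'X_i != a%:MP :> {mpoly C[n]}.
Proof.
apply/eqP => /(congr1 (mcoeff U_(i)))/eqP.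
by rewrite mcoeffX eqxx mcoeffC mnm1_eq0 mulr0 oner_eq0.
Qed.

Lemma dominant_nonconst (f : ratmap C) : dominant f -> forall a, cst a != f.1.
Proof.
move=> df a; apply: contraTneq isT => E.
have /df/eqP : mpoly_at f ('X_0 - a%:MP) = 0.
  by rewrite rmorphB /= mpoly_atX mpoly_atC E subrr.
by rewrite subr_eq0 (negPf (mpolyX_neqC _ _)).
Qed.

Lemma x_nonconst a : cst a != x.
Proof. exact: (dominant_nonconst (@dominant_id C)). Qed.

Lemma x_tr : transcendental_over (@cst C) x.
Proof. exact/transcendental_of_nonconst/x_nonconst. Qed.

(** The embedding of [C(x)] in [C(x, y)]. *)
Definition emb : {rmorphism E -> K} := rat_eval_rmorphism x_tr.

Lemma embC a : emb (ratC a) = cst a.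
Proof. exact: (rat_evalC x_tr a). Qed.

Lemma embX : emb (ratX C) = x.
Proof. exact: (rat_evalX x_tr). Qed.

Lemma x_off_poles : off_poles x.
Proof. exact: off_poles_nonconst x_nonconst. Qed.

Lemma y_neq0 : y != 0.
Proof. by rewrite tofrac_eq0 -[0]mpolyC0 mpolyX_neqC. Qed.

(** * The function field of the plane as fractions of C(x)[y] *)

Lemma clear_denominators (A : {poly E}) : exists (q : {poly C}) (B : {poly {poly C}}),
  q != 0 /\ tofrac q *: A = map_poly (@tofrac {poly C}) B.
Proof.
elim/poly_ind: A => [|A c [q [B [q0 AB]]]].
  by exists 1, 0; rewrite oner_eq0 scaler0 map_poly0.
have [n [d [d0 ->]]] := ratfunP c.
exists (q * d), (d%:P * B * 'X + (q * n)%:P); rewrite mulf_neq0 //; split=> //.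
rewrite rmorphD /= scalerDr map_polyC -[X in _ + X]mul_polyC -polyCM; congr (_ + _%:P).
  rewrite !rmorphM /= map_polyX map_polyC -AB mul_polyC.
  by rewrite [X in X *: _]mulrC -scalerA -!scalerAl.
rewrite tofracM [RHS]tofracM -mulrA; congr (_ * _).
by rewrite mulrC divfK // tofrac_eq0.
Qed.

Definition eval_y : {rmorphism {poly E} -> K} := horner_eval y \o map_poly emb.

Lemma eval_yE A : eval_y A = (map_poly emb A).[y].
Proof. by []. Qed.

Lemma eval_yC r : eval_y r%:P = emb r.
Proof. by rewrite eval_yE map_polyC hornerC. Qed.

Lemma eval_yX : eval_y 'X = y.
Proof. by rewrite eval_yE map_polyX hornerX. Qed.

Lemma emb_tofrac (p : {poly C}) :
  emb (tofrac p) = tofrac (map_poly (@mpolyC 2 C) p).['X_0].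
Proof.
rewrite [LHS](rat_eval_tofrac x_tr) -horner_map -map_poly_comp /=.
by [].
Qed.

(** [y] is transcendental over [C(x)]: after clearing denominators, a polynomial
    of [C[x][y]] is recovered from the polynomial in two variables that it
    defines. *)
Lemma eval_y_inj A : eval_y A = 0 -> A = 0.
Proof.
have [q [B [q0 AB]]] := clear_denominators A => A0.
pose uni (p : {poly C}) := (map_poly (@mpolyC 2 C) p).['X_0].
pose uniM : {rmorphism {poly C} -> {mpoly C[2]}} :=
  horner_eval ('X_0 : {mpoly C[2]}) \o map_poly (@mpolyC 2 C).
have B0 : (map_poly uniM B).['X_1] = 0.
  apply/eqP; rewrite -tofrac_eq0 -horner_map -map_poly_comp.
  have := congr1 eval_y AB; rewrite -mul_polyC rmorphM A0 mulr0 eval_yE.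
  rewrite -map_poly_comp => /esym/eqP; congr (_ == _); congr (_.[_]).
  by apply: eq_map_poly => p; exact: emb_tofrac.
pose back : {rmorphism {mpoly C[2]} -> {poly {poly C}}} :=
  mmap (polyC \o @polyC C) (fun i : 'I_2 => if i == 0 then 'X%:P else 'X).
have backC a : back a%:MP = a%:P%:P by exact: mmapC.
have backX i : back 'X_i = if i == 0 then 'X%:P else 'X.
  by rewrite /back /= mmapX mmap1U.
have := congr1 back B0; rewrite rmorph0 -horner_map -map_poly_comp backX /=.
have -> : map_poly (back \o uniM) B = map_poly polyC B.
  apply: eq_map_poly => p; rewrite /= /horner_eval -horner_map -map_poly_comp.
  rewrite backX eqxx (eq_map_poly (g := polyC \o polyC)) ?map_poly_comp //.
  by rewrite horner_map /= -/(comp_poly _ _) comp_polyXr.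
rewrite -/(comp_poly _ _) comp_polyXr => B00.
move/eqP: AB; rewrite B00 map_poly0 scaler_eq0 tofrac_eq0 (negPf q0).
by move/eqP.
Qed.

End Jonquieres.
Global Opaque emb eval_y.
Arguments emb {C}.
Arguments eval_y {C}.

Section JonquieresMaps.
Variable C : numClosedFieldType.
Local Notation E := (ratfun C).
Local Notation K := (ratfun2 C).
Local Notation x := (xvar C).
Local Notation y := (yvar C).
Local Notation emb := (@emb C).
Local Notation eval_y := (@eval_y C).

Definition jonq (M : SL2Z) (c : E) : ratmap C := (mob M x, emb c * y).

(** Substituting [jonq M c] in a polynomial in [y]. *)
Definition twist (M : SL2Z) (c : E) : {rmorphism {poly E} -> {poly E}} :=
  comp_poly (c *: 'X) \o map_poly (act M).

Lemma coef_twist M c A i : (twist M c A)`_i = act M A`_i * c ^+ i.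
Proof.
pose B := map_poly (act M) A; have BE j : B`_j = act M A`_j by exact: coef_map.
rewrite -BE -[LHS]/((B \Po (c *: 'X))`_i) comp_polyE coef_sum.
under eq_bigr => j _ do rewrite exprZn coefZ coefZ coefXn.
have [lti|lei] := ltnP i (size B).
  rewrite (bigD1 (Ordinal lti)) //= eqxx mulr1 big1 ?addr0 // => j /negPf ji.
  by rewrite eq_sym -(inj_eq val_inj) /= in ji; rewrite ji !mulr0.
rewrite big1 => [|j _]; last first.
  by case: eqP => [ij|_]; rewrite ?mulr0 //; have := ltn_ord j; rewrite -ij ltnNge lei.
by rewrite nth_default // mul0r.
Qed.

Lemma twist_inj M c A : c != 0 -> twist M c A = 0 -> A = 0.
Proof.
move=> c0 A0; apply/polyP => i; rewrite coef0; apply/eqP.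
have := congr1 (fun B : {poly E} => B`_i) A0; rewrite coef_twist coef0 => /eqP.
by rewrite mulf_eq0 expf_eq0 (negPf c0) andbF orbF fmorph_eq0.
Qed.

Lemma twistC M c r : twist M c r%:P = (act M r)%:P.
Proof.
by rewrite -[LHS]/(comp_poly _ (map_poly (act M) r%:P)) map_polyC comp_polyC.
Qed.

Lemma twistX M c : twist M c 'X = c *: 'X.
Proof.
by rewrite -[LHS]/(comp_poly _ (map_poly (act M) 'X)) map_polyX comp_polyX.
Qed.

Lemma twistD M c A B : twist M c (A + B) = twist M c A + twist M c B.
Proof. exact: (rmorphD (twist M c)). Qed.

Lemma twistM M c A B : twist M c (A * B) = twist M c A * twist M c B.
Proof. exact: (rmorphM (twist M c)). Qed.

Opaque twist.

Lemma eval_yD A B : eval_y (A + B) = eval_y A + eval_y B.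
Proof. exact: (rmorphD eval_y). Qed.

Lemma eval_yM A B : eval_y (A * B) = eval_y A * eval_y B.
Proof. exact: (rmorphM eval_y). Qed.

Lemma eval_yZX c : eval_y (c *: 'X) = emb c * y.
Proof. by rewrite -mul_polyC eval_yM eval_yC eval_yX. Qed.

Definition poly_of : {rmorphism {mpoly C[2]} -> {poly E}} :=
  mmap (polyC \o @ratC C) (fun i : 'I_2 => if i == 0 then (ratX C)%:P else 'X).

Lemma poly_ofC a : poly_of a%:MP = (ratC a)%:P.
Proof. exact: mmapC. Qed.

Lemma poly_ofX i : poly_of 'X_i = if i == 0 then (ratX C)%:P else 'X.
Proof. by rewrite /= mmapX mmap1U. Qed.

Lemma eval_y_poly_of p : eval_y (poly_of p) = tofrac p.
Proof.
have h : eval_y \o poly_of =1 @tofrac {mpoly C[2]}.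
  apply: mpoly_morph_ext => [a||]; rewrite -[LHS]/(eval_y (poly_of _)).
  - by rewrite poly_ofC eval_yC embC.
  - by rewrite poly_ofX eval_yC embX.
  - by rewrite poly_ofX eval_yX.
exact: h.
Qed.

Lemma emb_act M r : emb (act M r) = rat_eval (@cst C) (mob M x) r.
Proof.
have tr : transcendental_over (@cst C) (mob M x).
  exact/transcendental_of_nonconst/mob_nonconst/x_nonconst.
rewrite -[LHS]/((emb \o act M) r).
apply: (rat_eval_unique tr) => [a|]; rewrite -[LHS]/(emb (act M _)).
  by rewrite actC embC.
by rewrite actX mob_rmorph embX.
Qed.

Lemma mpoly_at_jonq M c p : mpoly_at (jonq M c) p = eval_y (twist M c (poly_of p)).
Proof.
have h : mpoly_at (jonq M c) =1 eval_y \o (twist M c \o poly_of).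
  apply: mpoly_morph_ext => [a||]; rewrite -[RHS]/(eval_y (twist M c (poly_of _)))
    -[LHS]/(mpoly_at (jonq M c) _).
  - by rewrite poly_ofC twistC eval_yC actC embC mpoly_atC.
  - by rewrite mpoly_atX poly_ofX /pt eqxx twistC eval_yC actX mob_rmorph embX.
  - by rewrite poly_ofX twistX eval_yZX mpoly_atX.
exact: h.
Qed.

Lemma jonq_dominant M c : c != 0 -> dominant (jonq M c).
Proof.
move=> c0 p; rewrite mpoly_at_jonq => /eval_y_inj/(twist_inj c0) p0.
by apply/eqP; rewrite -tofrac_eq0 -eval_y_poly_of p0 rmorph0.
Qed.

Lemma at_cst (f : ratmap C) a : dominant f -> ratfun2_at f (cst a) = cst a.
Proof. by move=> df; rewrite ratfun2_at_tofrac // mpoly_atC. Qed.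

Lemma at_x (f : ratmap C) : dominant f -> ratfun2_at f x = f.1.
Proof. by move=> df; rewrite ratfun2_at_tofrac // mpoly_atX. Qed.

Lemma at_y (f : ratmap C) : dominant f -> ratfun2_at f y = f.2.
Proof. by move=> df; rewrite ratfun2_at_tofrac // mpoly_atX. Qed.

Lemma at_emb (f : ratmap C) r : dominant f ->
  ratfun2_at f (emb r) = rat_eval (@cst C) f.1 r.
Proof.
move=> df; have tr : transcendental_over (@cst C) f.1.
  exact/transcendental_of_nonconst/dominant_nonconst.
rewrite -[LHS]/((ratfun2_at_rmorphism df \o emb) r).
apply: (rat_eval_unique tr) => [a|]; rewrite -[LHS]/(ratfun2_at f (emb _)).
  by rewrite embC at_cst.
by rewrite embX at_x.
Qed.

Lemma at_mul (f : ratmap C) r s : dominant f ->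
  ratfun2_at f (r * s) = ratfun2_at f r * ratfun2_at f s.
Proof. by move=> df; apply: (rmorphM (ratfun2_at_rmorphism df)). Qed.

Lemma at_mob (f : ratmap C) M r : dominant f ->
  ratfun2_at f (mob M r) = mob M (ratfun2_at f r).
Proof. by move=> df; apply: (mob_rmorph (ratfun2_at_rmorphism df)). Qed.

Lemma at_eval_y M c A : c != 0 ->
  ratfun2_at (jonq M c) (eval_y A) = eval_y (twist M c A).
Proof.
move=> c0; have df := @jonq_dominant M c c0.
elim/poly_ind: A => [|A r ih].
  by rewrite !rmorph0; exact: (rmorph0 (ratfun2_at_rmorphism df)).
have evD B D r' : eval_y (B * D + r'%:P) = eval_y B * eval_y D + emb r'.
  rewrite (eval_yD (B * D) r'%:P) (eval_yC r'); congr (_ + _); exact: eval_yM.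
have tw : twist M c (A * 'X + r%:P) = twist M c A * (c *: 'X) + (act M r)%:P.
  rewrite (twistD M c (A * 'X)) (twistC M c r); congr (_ + _).
  by rewrite (twistM M c A) (twistX M c).
apply: etrans (congr1 (ratfun2_at _) (evD A 'X r)) _.
apply: etrans _ (esym (etrans (congr1 eval_y tw) (evD _ _ _))).
move: ih (eval_yZX c) (eval_yX C); move: (eval_y (twist M c A)) (eval_y A)
  (eval_y 'X) (eval_y (c *: 'X)) => a b x' y' <- -> ->.
have -> : ratfun2_at (jonq M c) (b * y + emb r) =
    ratfun2_at (jonq M c) (b * y) + ratfun2_at (jonq M c) (emb r).
  exact: (rmorphD (ratfun2_at_rmorphism df)).
by rewrite at_mul // at_y // at_emb // emb_act.
Qed.

Lemma jonq_comp M N c d : d != 0 ->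
  ratmap_comp (jonq M c) (jonq N d) = jonq (M * N)%g (d * act N c).
Proof.
move=> d0; have df := @jonq_dominant N d d0; rewrite /ratmap_comp /=.
rewrite at_mob // at_x // at_mul // at_y // at_emb //=.
by rewrite -mobM ?x_off_poles // -emb_act mulrA -rmorphM mulrC [d * _]mulrC mulrC.
Qed.

Lemma jonq1 : jonq 1%g 1 = idmap C.
Proof. by rewrite /jonq mob1 rmorph1 mul1r. Qed.

Lemma jonq_inj M N c d : jonq M c = jonq N d -> mob M x = mob N x /\ c = d.
Proof. by move=> [-> /(mulIf (y_neq0 C))/fmorph_inj]. Qed.

Lemma jonq_bir M c : c != 0 -> exists h : bir C, bir_map h = jonq M c.
Proof.
move=> c0; have d0 : act M^-1%g c^-1 != 0 by rewrite fmorph_eq0 invr_eq0.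
apply: (bir_of_inverse (g := jonq M^-1%g (act M^-1%g c^-1))).
  by rewrite (jonq_comp _ _ _ d0) mulgV -act_mul (mulVf c0) act_one jonq1.
by rewrite (jonq_comp _ _ _ c0) mulVg actM mulVg act1 (divff c0) jonq1.
Qed.

Lemma mob_x_eq1 M : mob M x = x -> M = 1%g \/ M = SL2Z_N1.
Proof.
rewrite -embX -mob_rmorph => /fmorph_inj h; set t := ratX C in h.
have E : mnum M t = t * mden M t by rewrite -{2}h divfK ?ratX_off_poles.
pose e i j : C := (ent M i j)%:~R.
pose p : {poly C} := (e 1 0)%:P * 'X * 'X + (e 1 1 - e 0 0)%:P * 'X - (e 0 1)%:P.
have p0 : p = 0.
  apply/eqP; rewrite -tofrac_eq0 /p tofracB tofracD !tofracM -/(ratX C) -/t.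
  rewrite -!/(ratC _) rmorphB !rmorph_int; apply/eqP; move: E; rewrite /mnum /mden.
  move: t (_%:~R) (_%:~R) (_%:~R) (_%:~R) {h}.
  move=> t a b c d E; have -> : b * t * t + (a - d) * t - c =
    t * (b * t + a) - (d * t + c) by ring.
  by rewrite E subrr.
have e0 (z : int) : z%:~R = 0 :> C -> z = 0 by move/eqP; rewrite intr_eq0 => /eqP.
have := congr1 (fun q : {poly C} => q`_0) p0.
have := congr1 (fun q : {poly C} => q`_1) p0.
have := congr1 (fun q : {poly C} => q`_2) p0.
rewrite !(coefB, coefD, coefMX, coefC) /= !(subr0, addr0, add0r, sub0r).
move=> /e0 h10 /eqP; rewrite subr_eq0 eqr_int => /eqP h11 /eqP.
rewrite oppr_eq0 => /eqP/e0 h01.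
have := ent_det M; rewrite h10 h01 h11 mul0r subr0 => det.
have [h00|h00] : ent M 0 0 = 1 \/ ent M 0 0 = -1.
  have : absz (ent M 0 0 * ent M 0 0) = 1%N by rewrite det.
  by rewrite abszM => /eqP; rewrite muln_eq1 => /andP[_ /eqP]; lia.
- by left; apply: SL2Z_eqE; rewrite ?h10 ?h01 ?h11 ?h00 ?ent1.
- by right; apply: SL2Z_eqE; rewrite ?h10 ?h01 ?h11 ?h00 ?entN1.
Qed.

End JonquieresMaps.

(** * The divisor of an admissible function *)

Section Admissible.
Variable C : numClosedFieldType.
Local Notation E := (ratfun C).
Local Notation N1 := SL2Z_N1.

Lemma mup_prodX a (s : seq C) : mup a (prodX s) = count_mem a s.
Proof.
elim: s => [|b s ih]; first by rewrite /prodX big_nil mupNroot ?root1.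
rewrite /prodX big_cons -/(prodX s) mupM ?prodX_neq0 ?polyXsubC_eq0 // ih /=.
by have := mup_XsubCX 1 a b; rewrite expr1 => ->; case: (b == a).
Qed.

Lemma same_mup (p q : {poly C}) : p != 0 -> q != 0 ->
  (forall a, mup a p = mup a q) -> exists2 k, k != 0 & p = k%:P * q.
Proof.
have [r rE] := closed_field_poly_normal p; have [s sE] := closed_field_poly_normal q.
move=> nzp nzq E; have lp : lead_coef p != 0 by rewrite lead_coef_eq0.
have lq : lead_coef q != 0 by rewrite lead_coef_eq0.
exists (lead_coef p / lead_coef q); first by rewrite mulf_neq0 ?invr_eq0.
have mupZ (k : C) (u : seq C) a : k != 0 -> mup a (k *: prodX u) = count_mem a u.
  by move=> k0; rewrite -mul_polyC mupMr ?mup_prodX // rootC.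
have rs : perm_eq r s.
  apply/allP => a _ /=.
  by rewrite -(mupZ (lead_coef p)) // -rE E -(mupZ (lead_coef q)) // -sE.
rewrite [in LHS]rE [in RHS]sE (perm_big _ rs) /= mul_polyC scalerA.
by rewrite lead_coefZ (monicP (monic_prod_XsubC _ _ _)) mulr1 divfK.
Qed.

Lemma moebius_Some M (a : C) : mden M a != 0 -> moebius M (Some a) = Some (mob M a).
Proof. by rewrite /moebius -/(mden M a) => /negPf ->. Qed.

(** A point that some [M] sends to infinity is fixed by the conjugate of a
    translation, so it has isotropy. *)
Lemma no_isotropy_off_poles (a : C) : no_isotropy (Some a) -> off_poles a.
Proof.
move=> iso M; apply: contraT; rewrite negbK => /eqP d0.
set c := ent M 1 0; set d := ent M 1 1.
have det1 : \det (mx22 (1 - d * c) (- (d * d)) (c * c) (1 + c * d)) == 1.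
  by rewrite det_mx22; apply/eqP; ring.
pose N : SL2Z := Sub (mx22 (1 - d * c) (- (d * d)) (c * c) (1 + c * d)) det1.
have eN : ((ent N 0 0 = 1 - d * c) * (ent N 0 1 = - (d * d)) *
    (ent N 1 0 = c * c) * (ent N 1 1 = 1 + c * d)).
  by rewrite /ent /= !mxE.
have ca : c%:~R * a = - d%:~R.
  by apply/eqP; rewrite -addr_eq0; apply/eqP; exact: d0.
have den : mden N a = 1.
  rewrite /mden !eN !(rmorphD, rmorphM) /= -mulrA ca; ring.
have num : mnum N a = a.
  rewrite /mnum !eN !(rmorphD, rmorphM, rmorphN, rmorphB) /=.
  by rewrite mulrBl -mulrA ca; ring.
have fix_a : moebius N (Some a) = Some a.
  by rewrite moebius_Some ?den ?oner_eq0 // /mob den num divr1.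
have c0 : c = 0.
  have : c * c = 0 by have [E|E] := iso N fix_a; rewrite -[LHS](eN.1.2) E ?ent1 ?entN1.
  by move/eqP; rewrite mulf_eq0 orbb => /eqP.
have := ent_row1_neq0 M; rewrite -/c -/d c0 eqxx /=.
by move: d0; rewrite /mden -/c -/d c0 mul0r add0r => /eqP; rewrite intr_eq0 => /eqP ->.
Qed.

Lemma calP_data (P : E) : calP P -> exists (m : nat) (zs ps : seq C),
  [/\ (0 < m)%N, size zs = m /\ size ps = m, general_position (zs ++ ps)
    & has_div P zs ps].
Proof.
move=> [P0 [m [poles [zeros [[m0 us] ordp ordz ord0 [orb iso]]]]]].
have mem : (zeros ++ poles : seq C) =i (poles ++ zeros : seq C).
  by move=> a; rewrite !mem_cat orbC.
exists m, zeros, poles; split=> //; first by rewrite !size_tuple.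
- split=> [|a|a b]; rewrite ?mem; first by rewrite uniq_catC.
    by move/iso/no_isotropy_off_poles.
  move=> ha hb M E; have off := no_isotropy_off_poles (iso a ha).
  have Mab : moebius M (Some a) = Some b by rewrite moebius_Some ?off // E.
  have [ab|nab] := eqVneq a b; last by case: (orb a b ha hb nab); exists M.
  by split=> //; apply: (iso a ha); rewrite Mab ab.
have [n [d [d0 PE]]] := ratfunP P.
have n0 : n != 0 by apply: contraNneq P0 => n0; rewrite PE n0 tofrac0 mul0r.
have [|||k k0 E] := @same_mup (n * prodX poles) (d * prodX zeros).
- by rewrite mulf_neq0 ?prodX_neq0.
- by rewrite mulf_neq0 ?prodX_neq0.
- move=> a; rewrite !mupM ?prodX_neq0 // !mup_prodX.
  have := ratfun_ord_Some a n0 d0; rewrite -PE.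
  move: us; rewrite cat_uniq => /and3P[up hpz uz].
  rewrite !count_uniq_mem //.
  have [ap|ap] := boolP (a \in poles).
    have /negPf -> : a \notin zeros by apply: contraL ap => /(hasPn hpz).
    by rewrite (ordp a ap); lia.
  have [az|az] := boolP (a \in zeros); first by rewrite (ordz a az); lia.
  rewrite ord0 ?mem_map //; first by lia.
    by rewrite mem_cat negb_or ap.
  by move=> ? ? [].
exists k => //; rewrite PE; apply/eqP.
rewrite mulrA eqr_div ?tofrac_eq0 ?prodX_neq0 // -!tofracM tofrac_eq E.
by rewrite mulrAC -mulrA mulrC.
Qed.

End Admissible.

(** * The morphisms theta_P *)

Section Theta.
Variable C : numClosedFieldType.
Local Notation E := (ratfun C).
Local Notation x := (xvar C).
Local Notation y := (yvar C).
Local Notation S := SL2Z_S.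
Local Notation T := (SL2Z_R * SL2Z_S)%g.
Local Notation N1 := SL2Z_N1.

Lemma jonqS : jonq S (ratC 'i : E) = (- x^-1, cst 'i * y).
Proof.
rewrite /jonq embC; congr (_, _).
by rewrite /mob /mnum /mden !entS mul0r add0r addr0 mulN1r invrN mul1r.
Qed.

Lemma mobTx : mob T x = (x - 1) / x.
Proof.
rewrite /mob /mnum /mden !entT addr0 !mulN1r addrC invrN mulrN -mulNr opprB.
by [].
Qed.

Lemma jonqT (P : E) : jonq T (act T P / P) =
  ((x - 1) / x, y * (ratfun_at P ((x - 1) / x) / ratfun_at P x)).
Proof.
rewrite /jonq fmorph_div emb_act -mobTx; congr (_, _); rewrite mulrC.
by congr (y * (_ / _)); rewrite -[P in LHS]act1 emb_act mob1.
Qed.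

Lemma morphism_thetaE (P : E) (theta : SL2Z -> bir C) : morphism_theta P theta <->
  [/\ {morph theta : M N / (M * N)%g}, bir_map (theta S) = jonq S (ratC 'i)
    & bir_map (theta T) = jonq T (act T P / P)].
Proof. by rewrite /morphism_theta jonqS jonqT. Qed.

Lemma theta1 (theta : SL2Z -> bir C) : {morph theta : M N / (M * N)%g} ->
  theta 1%g = 1%g.
Proof. by move=> h; apply: (mulgI (theta 1%g)); rewrite -h !mulg1. Qed.

(** The values of [theta_P] preserve the pencil of vertical lines; their second
    coordinates form a cocycle. *)
Lemma theta_cocycle (P : E) theta : P != 0 -> morphism_theta P theta ->
  exists c : SL2Z -> E, [/\ forall M, c M != 0,
    forall M, bir_map (theta M) = jonq M (c M),
    forall M N, c (M * N)%g = c N * act N (c M),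
    c S = ratC 'i & c T = act T P / P].
Proof.
move=> P0 /morphism_thetaE [hM hS hT].
have i0 : ratC 'i != 0 :> E by rewrite fmorph_eq0 neq0Ci.
have t0 : act T P / P != 0 := mulf_neq0 (act_neq0 T P0) (invr_neq0 P0).
have ex M : exists c : E, c != 0 /\ bir_map (theta M) = jonq M c.
  elim/SL2Z_ind: M => [|M [c [c0 E]]|M [c [c0 E]]].
  - exists 1; rewrite oner_eq0 (theta1 hM) jonq1; split=> //; exact: erefl.
  - exists (c * act M (ratC 'i)); split; first exact: mulf_neq0 c0 (act_neq0 M i0).
    rewrite hM bir_mapM hS E (jonq_comp _ _ _ c0); exact: erefl.
  - exists (c * act M (act T P / P)); split; first exact: mulf_neq0 c0 (act_neq0 M t0).
    rewrite hM bir_mapM hT E (jonq_comp _ _ _ c0); exact: erefl.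
have [c cP] := choice ex; have c0 M : c M != 0 by case: (cP M).
have cE M : bir_map (theta M) = jonq M (c M) by case: (cP M).
exists c; split=> // [M N||].
- have := cE (M * N)%g; rewrite hM bir_mapM !cE (jonq_comp _ _ _ (c0 N)).
  by move=> /jonq_inj [].
- by have := cE S; rewrite hS => /jonq_inj [].
- by have := cE T; rewrite hT => /jonq_inj [].
Qed.

Lemma theta_exists_unique (P : E) : P != 0 ->
  exists! theta : SL2Z -> bir C, morphism_theta P theta.
Proof.
move=> P0; have i0 : ratC 'i != 0 :> E by rewrite fmorph_eq0 neq0Ci.
have aP0 M : act M P != 0 := act_neq0 M P0.
have t0 : act T P / P != 0 := mulf_neq0 (aP0 T) (invr_neq0 P0).
have [s sE] := jonq_bir S i0; have [t tE] := jonq_bir T t0.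
have ss : bir_map (s * s)%g = jonq N1 (ratC (-1)).
  rewrite bir_mapM sE (jonq_comp _ _ _ i0) actC SS_N1 -rmorphM -expr2 sqrCi.
  exact: erefl.
have n0 : ratC (-1) != 0 :> E by rewrite fmorph_eq0 oppr_eq0 oner_eq0.
have actD N (r r' : E) : act N (r / r') = act N r / act N r' by exact: fmorph_div.
have tt : bir_map (t * t)%g = jonq (T * T)%g (act (T * T)%g P / P).
  rewrite bir_mapM tE (jonq_comp _ _ _ t0) actD actM mulrC mulrA (divfK (aP0 T)).
  exact: erefl.
have [||| theta [hM hS hT]] := @SL2Z_presentation (bir C) s t.
- apply: bir_map_inj; rewrite -mulgA bir_mapM ss (jonq_comp _ _ _ n0) actC N1N1.
  rewrite -rmorphM mulrNN mulr1 rmorph1 jonq1; exact: erefl.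
- apply: bir_map_inj; rewrite bir_mapM tt tE (jonq_comp _ _ _ t0) actD actM T3 act1.
  rewrite mulrA (divfK P0) (divff (aP0 T)) jonq1; exact: erefl.
- rewrite -[RHS]mulgA; apply: bir_map_inj; rewrite bir_mapM [RHS]bir_mapM ss tE.
  rewrite (jonq_comp _ _ _ n0) (jonq_comp _ _ _ t0) actC N1C.
  have aN r : act N1 r = r :> E.
    rewrite -[LHS]/(act _ _) -[RHS]/((idfun : {rmorphism E -> E}) r).
    apply: ratfun_morph_ext => [a|]; rewrite -[RHS]/(id _); first exact: actC.
    by rewrite actX -[N1]mulg1 mobN1 mob1.
  rewrite aN mulrC; exact: erefl.
exists theta; split.
  by apply/morphism_thetaE; split; rewrite ?hS ?hT.
move=> theta' /morphism_thetaE [hM' hS' hT']; apply/funext => M.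
elim/SL2Z_ind: M => [|M ih|M ih]; first by rewrite !theta1.
- have eS : theta' S = s by apply: bir_map_inj; rewrite hS' sE; exact: erefl.
  rewrite hM hM' ih hS eS; exact: erefl.
- have eT : theta' T = t by apply: bir_map_inj; rewrite hT' tE; exact: erefl.
  rewrite hM hM' ih hT eT; exact: erefl.
Qed.

Lemma theta_inj (P : E) theta : P != 0 -> morphism_theta P theta ->
  injective theta.
Proof.
move=> P0 hP; have [c [c0 cE cM cS cT]] := theta_cocycle P0 hP.
have [hM _ _] := hP.
have ker M : theta M = 1%g -> M = 1%g.
  move=> M1; have := cE M; rewrite M1 bir_map1 -jonq1 => /jonq_inj [/esym].
  rewrite mob1 => /mob_x_eq1 [->//|ME] cM1; move: cM1; rewrite ME -SS_N1 cM cS actC.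
  rewrite -rmorphM -expr2 sqrCi => /eqP; rewrite -(rmorph1 (@ratC C)).
  rewrite (inj_eq (fmorph_inj _)) -subr_eq0 opprK -[1 + 1]/(2%:R) pnatr_eq0.
  by [].
move=> M N MN; apply: (mulIg N^-1%g); rewrite mulgV; apply: ker.
by rewrite hM MN -hM mulgV theta1.
Qed.

End Theta.

(** * Degrees *)

Section Vanishing.
Variable C : numClosedFieldType.

Lemma poly_vanish (q : {poly C}) : (forall t, q.[t] = 0) -> q = 0.
Proof.
move=> q0; apply: contraTeq isT => nz; suff : (size q < size q)%N by rewrite ltnn.
have := @max_poly_roots _ q [seq i%:R | i <- iota 0 (size q)] nz.
rewrite size_map size_iota; apply; last first.
  by rewrite map_inj_uniq ?iota_uniq // => i j /eqP; rewrite eqr_nat => /eqP.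
by apply/allP => t _; apply/rootP.
Qed.

Lemma poly_nonvanish (q : {poly C}) : q != 0 -> exists t, q.[t] != 0.
Proof.
move=> nz; apply: contrapT => h; case/eqP: nz; apply: poly_vanish => t.
by apply/eqP; apply: contrapT => /negP ht; apply: h; exists t.
Qed.

Lemma digits_inj n B (f g : 'I_n -> nat) :
  (forall i, f i < B)%N -> (forall i, g i < B)%N ->
  (\sum_i f i * B ^ i = \sum_i g i * B ^ i)%N -> f =1 g.
Proof.
elim: n f g => [|n ih] f g fB gB E i; first by case: i.
have recl (h : 'I_n.+1 -> nat) : (\sum_i h i * B ^ i =
    h ord0 + B * \sum_(i < n) h (lift ord0 i) * B ^ i)%N.
  rewrite big_ord_recl expn0 muln1 big_distrr /=; congr (_ + _)%N.
  by apply: eq_bigr => k _; rewrite /bump /= add1n expnS mulnCA.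
have B0 : (0 < B)%N by apply: leq_ltn_trans (fB ord0).
rewrite !recl in E; have e0 : f ord0 = g ord0.
  have := congr1 (modn^~ B) E.
  by rewrite /= ![(B * _)%N]mulnC !(addnC (_ ord0)) !modnMDl !modn_small.
move: E; rewrite e0 => /addnI/eqP; rewrite eqn_pmul2l // => /eqP E.
have [j ->|->] := unliftP ord0 i; last exact: e0.
exact: (ih (f \o lift ord0) (g \o lift ord0) (fun k => fB _) (fun k => gB _) E).
Qed.

(** Kronecker substitution: [X_i := t^(B^i)] separates the monomials of [p] as
    soon as [B] exceeds its degree. *)
Lemma mpoly_vanish n (p : {mpoly C[n]}) : (forall v, p.@[v] = 0) -> p = 0.
Proof.
move=> p0; pose B := (msize p).+1; pose k (m : 'X_{1..n}) := (\sum_i m i * B ^ i)%N.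
pose q : {poly C} := \sum_(m <- msupp p) p@_m *: 'X^(k m).
have q0 : q = 0.
  apply: poly_vanish => t; rewrite -(p0 (fun i => t ^+ (B ^ i))) mevalE.
  rewrite horner_sum; apply: eq_bigr => m _; rewrite hornerZ hornerXn; congr (_ * _).
  by rewrite expr_sum; apply: eq_bigr => i _; rewrite -exprM mulnC.
have lt m i : m \in msupp p -> (m i < B)%N.
  move=> /msize_mdeg_lt hm; rewrite ltnS; apply: leq_trans (ltnW hm).
  by rewrite mdegE (bigD1 i) //= leq_addr.
have kinj : {in msupp p &, injective k}.
  move=> m m' hm hm' E; apply/mnmP.
  by apply: digits_inj E => i; apply: lt.
apply/mpolyP => m; rewrite mcoeff0; apply: contraTeq isT.
rewrite -mcoeff_msupp => hm; move/eqP: q0; apply: contraLR => _.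
apply/eqP => /(congr1 (fun q : {poly C} => q`_(k m))).
rewrite coef0 coef_sum (bigD1_seq m) ?msupp_uniq //= coefZ coefXn eqxx mulr1.
rewrite big_seq_cond big1 ?addr0; first by move/eqP; rewrite mcoeff_eq0 hm.
move=> m' /andP[hm' nm]; rewrite coefZ coefXn; case: eqP => [/kinj E|]; rewrite ?mulr0 //.
by rewrite E // eqxx in nm.
Qed.

End Vanishing.

Section Homogenize.
Variable C : numClosedFieldType.
Local Notation E := (ratfun C).

(** The form of degree [e] in [X, Z] with dehomogenization [p]. *)
Definition homogenize (e : nat) (p : {poly C}) : {mpoly C[3]} :=
  \sum_(i < e.+1) p`_i *: ('X_0 ^+ i * 'X_2 ^+ (e - i)).

Definition pt3 (a b c : C) : 'I_3 -> C := fun i => nth 0 [:: a; b; c] i.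

Lemma dhomogXi (n : nat) (i : 'I_n) : ('X_i : {mpoly C[n]}) \is 1.-homog.
Proof. by rewrite dhomogX; apply/eqP; exact: mdeg1. Qed.

Lemma homogenize_dhomog e p : homogenize e p \is e.-homog.
Proof.
apply: rpred_sum => i _; apply: rpredZ.
have := dhomogM (dhomogMn i (dhomogXi (0 : 'I_3))) (dhomogMn (e - i) (dhomogXi (2 : 'I_3))).
by rewrite !mul1n subnKC // (ltnSE (ltn_ord i)).
Qed.

Lemma meval_homogenize e p v : (homogenize e p).@[v] =
  \sum_(i < e.+1) p`_i * (v 0 ^+ i * v 2 ^+ (e - i)).
Proof.
rewrite raddf_sum /=; apply: eq_bigr => i _.
by rewrite mevalZ mevalM !rmorphXn /= !mevalXU.
Qed.

Lemma meval_homogenize_affine e (p : {poly C}) (v : 'I_3 -> C) : v 2 != 0 ->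
  (size p <= e.+1)%N -> (homogenize e p).@[v] = v 2 ^+ e * p.[v 0 / v 2].
Proof.
move=> v2 sp; rewrite meval_homogenize (horner_coef_wide _ sp) mulr_sumr.
apply: eq_bigr => i _; rewrite [RHS]mulrCA; congr (_ * _).
have -> : v 2 ^+ e = v 2 ^+ i * v 2 ^+ (e - i).
  by rewrite -exprD subnKC // (ltnSE (ltn_ord i)).
rewrite [RHS]mulrAC; congr (_ * _).
by rewrite -exprMn [v 2 * _]mulrC divfK.
Qed.

Lemma meval_homogenize_inf e (p : {poly C}) (v : 'I_3 -> C) : v 2 = 0 ->
  (homogenize e p).@[v] = p`_e * v 0 ^+ e.
Proof.
move=> v2; rewrite meval_homogenize big_ord_recr /= subnn expr0 mulr1 big1 ?add0r //.
by move=> i _; rewrite v2 expr0n subn_eq0 leqNgt ltn_ord !mulr0.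
Qed.

Lemma dehomX (i : 'I_3) :
  dehom ('X_i : {mpoly C[3]}) = nth 0 [:: xvar C; yvar C; 1] i.
Proof. by rewrite /dehom mmapX mmap1U. Qed.

Lemma dehomM (F G : {mpoly C[3]}) : dehom (F * G) = dehom F * dehom G.
Proof. exact: (rmorphM (mmap _ _)). Qed.

Lemma dehom_homogenize e (p : {poly C}) : (size p <= e.+1)%N ->
  dehom (homogenize e p) = emb (tofrac p).
Proof.
move=> sp; have dX (F : {mpoly C[3]}) k : dehom (F ^+ k) = dehom F ^+ k.
  exact: (rmorphXn (mmap _ _)).
have dZ c (F : {mpoly C[3]}) : dehom (c *: F) = cst c * dehom F by exact: mmapZ.
have dsum : dehom (homogenize e p) =
    \sum_(i < e.+1) dehom (p`_i *: ('X_0 ^+ i * 'X_2 ^+ (e - i))).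
  exact: (raddf_sum (mmap _ _)).
rewrite dsum emb_tofrac (horner_coef_wide _ (n := e.+1)); last first.
  by apply: leq_trans sp; exact: size_poly.
rewrite [RHS]raddf_sum; apply: eq_bigr => i _.
rewrite dZ dehomM !dX !dehomX /= expr1n mulr1 coef_map /= tofracM rmorphXn.
exact: erefl.
Qed.

End Homogenize.

Section Degree.
Variable C : numClosedFieldType.
Local Notation E := (ratfun C).

Lemma horner_line n (G : {mpoly C[n]}) (v w : 'I_n -> C) :
  exists r : {poly C}, forall t, r.[t] = G.@[fun i => v i + t * w i].
Proof.
exists (mmap (@polyC C) (fun i => (v i)%:P + (w i)%:P * 'X) G) => t.
rewrite mevalE horner_sum; apply: eq_bigr => m _.
rewrite hornerM hornerC horner_prod; congr (_ * _); apply: eq_bigr => i _.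
by rewrite horner_exp hornerD hornerC hornerM hornerC hornerX [w i * t]mulrC.
Qed.

Lemma const_on_line n (G : {mpoly C[n]}) (v w : 'I_n -> C) :
  (forall t, G.@[fun i => v i + t * (w i - v i)] != 0) -> G.@[v] = G.@[w].
Proof.
move=> nz; have [r rE] := horner_line G v (fun i => w i - v i).
have /size_poly1P [k _ rk] : size r == 1.
  by apply: contraT => /closed_rootP[a]; rewrite /root rE (negPf (nz a)).
have := rE 0; have := rE 1; rewrite rk !hornerC => e1 e0.
rewrite (_ : G.@[v] = k) ?[RHS](_ : _ = k) //.
  by rewrite e1; apply: meval_eq => i; rewrite mul1r addrC subrK.
by rewrite e0; apply: meval_eq => i; rewrite mul0r addr0.
Qed.

Lemma pt3_line0 (a t : C) : a + t * (a - a) = a.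
Proof. by rewrite subrr mulr0 addr0. Qed.

(** Forms with finitely many common zeros in the projective plane have no
    common factor: [G] is constant on each line that avoids their zeros, hence
    everywhere. *)
Lemma no_common_factor_forms (d : nat) (p0 p1 p2 : {poly C}) : p2 != 0 ->
  (size p0 <= d.+2)%N -> (size p1 <= d.+1)%N -> (size p2 <= d.+2)%N ->
  (forall a, ~ [/\ root p0 a, root p1 a & root p2 a]) ->
  ~ [/\ p0`_d.+1 = 0, p1`_d = 0 & p2`_d.+1 = 0] ->
  no_common_factor (fun i : 'I_3 => nth 0
    [:: homogenize d.+1 p0; 'X_1 * homogenize d p1; homogenize d.+1 p2] i).
Proof.
move=> nz2 s0 s1 s2 noroot notop G Gdiv.
have zF F v : (exists H, F = G * H) -> G.@[v] = 0 -> F.@[v] = 0.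
  by move=> [H ->] G0; rewrite mevalM G0 mul0r.
have zero a b c : G.@[pt3 a b c] = 0 -> b != 0 -> a = 0 /\ c = 0.
  move=> G0 b0; have z0 : (homogenize d.+1 p0).@[pt3 a b c] = 0 := zF _ _ (Gdiv 0) G0.
  have z2 : (homogenize d.+1 p2).@[pt3 a b c] = 0 := zF _ _ (Gdiv 2) G0.
  have z1 : (homogenize d p1).@[pt3 a b c] = 0.
    have : ('X_1 * homogenize d p1).@[pt3 a b c] = 0 := zF _ _ (Gdiv 1) G0.
    by rewrite mevalM mevalXU => /eqP; rewrite mulf_eq0 (negPf b0) => /eqP.
  have c0 : c = 0.
    apply/eqP; apply: contraT => c0; case: (noroot (a / c)).
    move: z0 z1 z2; rewrite !meval_homogenize_affine // => /eqP + /eqP + /eqP.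
    by rewrite !mulf_eq0 !expf_eq0 (negPf c0) !andbF.
  split=> //; apply/eqP; apply: contraT => a0; case: notop.
  move: z0 z1 z2; rewrite !meval_homogenize_inf // => /eqP + /eqP + /eqP.
  by rewrite !mulf_eq0 !expf_eq0 (negPf a0) !andbF !orbF => /eqP -> /eqP -> /eqP ->.
have [|t] := @poly_nonvanish C (p2 * 'X); first by rewrite mulf_neq0 ?polyX_eq0.
rewrite hornerM hornerX mulf_eq0 negb_or => /andP[p2t t0].
have nzt s : G.@[pt3 t s 1] != 0.
  apply: contraNneq p2t => /(zF (homogenize d.+1 p2) _ (Gdiv 2)).
  rewrite meval_homogenize_affine ?oner_eq0 //=.
  by rewrite expr1n mul1r divr1 => ->.
have line v w : (forall t, G.@[pt3 (v 0 + t * (w 0 - v 0)) (v 1 + t * (w 1 - v 1))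
    (v 2 + t * (w 2 - v 2))] != 0) -> G.@[v] = G.@[w].
  move=> h; apply: const_on_line => s; have := h s; congr (_ != _).
  apply: meval_eq => i; have [->|[->|->]] // : i = 0 \/ i = 1 \/ i = 2.
  by case: i => -[|[|[|//]]] hi; [left|right; left|right; right]; exact: val_inj.
pose c := G.@[pt3 t 1 1]; exists c; first exact: nzt.
have Gc v : v 1 != 0 -> v 2 != 0 -> G.@[v] = c.
  move=> v1 v2.
  have nz s a b : b != 0 -> (a != 0) || (s != 0) -> G.@[pt3 a b s] != 0.
    move=> b0; apply: contraTneq => /zero/(_ b0) [-> ->]; by rewrite eqxx.
  rewrite (line v (pt3 t (v 1) (v 2))) => [|s]; last first.
    by apply: nz; rewrite /= pt3_line0 ?v2 ?orbT.
  rewrite (line _ (pt3 t (v 1) 1)) => [|s]; last first.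
    by apply: nz; rewrite /= pt3_line0 ?t0.
  rewrite (line _ (pt3 t 1 1)) // => s.
  by rewrite /= !pt3_line0; apply: nzt.
have : (G - c%:MP) * ('X_1 * 'X_2) = 0.
  apply: mpoly_vanish => v; rewrite mevalM mevalB mevalM mevalC !mevalXU.
  have [->|v1] := eqVneq (v 1) 0; first by rewrite mul0r mulr0.
  have [->|v2] := eqVneq (v 2) 0; first by rewrite !mulr0.
  by rewrite Gc // subrr mul0r.
move/eqP; rewrite !mulf_eq0 -[X in (_ == X) || _]mpolyC0 -mpolyC0.
by rewrite !(negPf (mpolyX_neqC _ _)) !orbF mpolyC0 subr_eq0 => /eqP.
Qed.

End Degree.

Section JonquieresDegree.
Variable C : numClosedFieldType.
Local Notation E := (ratfun C).
Local Notation x := (xvar C).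
Local Notation y := (yvar C).

(** A common root of the quotients would give a larger common divisor. *)
Lemma strip_gcd (q0 q1 q2 : {poly C}) : q1 != 0 -> q2 != 0 ->
  exists g p0 p1 p2 : {poly C}, [/\ g != 0, [/\ q0 = p0 * g, q1 = p1 * g & q2 = p2 * g],
    [/\ (size p0 <= size q0)%N, (size p1 <= size q1)%N & (size p2 <= size q2)%N]
    & forall a, ~ [/\ root p0 a, root p1 a & root p2 a]].
Proof.
move=> nz1 nz2; set g := gcdp q0 (gcdp q1 q2).
have g0 : g != 0 by rewrite !gcdp_eq0 (negPf nz2) !andbF.
have d0 : g %| q0 by exact: dvdp_gcdl.
have d1 : g %| q1 by exact: dvdp_trans (dvdp_gcdr _ _) (dvdp_gcdl _ _).
have d2 : g %| q2 by exact: dvdp_trans (dvdp_gcdr _ _) (dvdp_gcdr _ _).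
have sz q : (size (q %/ g)%R <= size q)%N by exact: leq_divp.
exists g, (q0 %/ g), (q1 %/ g), (q2 %/ g); rewrite !divpK //; split=> // a.
rewrite !root_factor_theorem => -[h0 h1 h2].
have step q : g %| q -> 'X - a%:P %| q %/ g -> ('X - a%:P) * g %| q.
  by move=> /divpK <-; rewrite mulpK // dvdp_mul2r.
have : ('X - a%:P) * g %| g by rewrite {2}/g !dvdp_gcd !step.
by move/(dvdp_leq g0); rewrite size_mul ?polyXsubC_eq0 // size_XsubC addSn /= add1n ltnn.
Qed.

(** The degree of a Jonquieres map differs by a bounded amount from the height
    of its second coordinate. *)
Lemma jonq_degree (f : bir C) M (c : E) k : c != 0 -> bir_map f = jonq M c ->
  ht_le c k -> exists d, [/\ bir_degree f d, (d <= k + 2)%N & ht_le c d].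
Proof.
move=> c0 fE [A [B [B0 sA sB cE]]].
have A0 : A != 0 by apply: contraNneq c0 => A0; rewrite cE A0 tofrac0 mul0r.
pose e i j : C := (ent M i j)%:~R.
pose N : {poly C} := (e 0 0)%:P * 'X + (e 0 1)%:P.
pose L : {poly C} := (e 1 0)%:P * 'X + (e 1 1)%:P.
have tN : tofrac N = mnum M (ratX C).
  by rewrite /N tofracD tofracM -/(ratX C) -!/(ratC _) !rmorph_int.
have tL : tofrac L = mden M (ratX C).
  by rewrite /L tofracD tofracM -/(ratX C) -!/(ratC _) !rmorph_int.
have L0 : L != 0 by rewrite -tofrac_eq0 tL ratX_off_poles.
have sl (u v : C) : (size (u%:P * 'X + v%:P)%R <= 2)%N.
  by rewrite size_MXaddC; case: ifP => // _; rewrite size_polyC; case: (u != 0).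
have [||g [p0 [p1 [p2 [g0 [E0 E1 E2] [s0 s1 s2] noroot]]]]] :=
  @strip_gcd (N * B) (A * L) (L * B); rewrite ?mulf_neq0 //.
have nz1 : p1 != 0.
  by apply: contraTneq isT => z; move/eqP: E1; rewrite z mul0r mulf_eq0 (negPf A0) (negPf L0).
have nz2 : p2 != 0.
  by apply: contraTneq isT => z; move/eqP: E2; rewrite z mul0r mulf_eq0 (negPf L0) (negPf B0).
have b0 : (size p0 <= k.+2)%N.
  by apply: leq_trans s0 _; apply: (size_mul_le (k := 1) (l := k)) => //; apply: sl.
have b1 : (size p1 <= k.+2)%N.
  by apply: leq_trans s1 _; rewrite mulrC; apply: (size_mul_le (k := 1) (l := k)) => //; apply: sl.
have b2 : (size p2 <= k.+2)%N.
  by apply: leq_trans s2 _; apply: (size_mul_le (k := 1) (l := k)) => //; apply: sl.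
have frac (q q' p p' : {poly C}) : q = p * g -> q' = p' * g -> q' != 0 ->
    tofrac q / tofrac q' = tofrac p / tofrac p'.
  move=> -> ->; rewrite mulf_eq0 negb_or => /andP[nz _]; apply/eqP.
  rewrite eqr_div ?tofrac_eq0 ?mulf_neq0 // -!tofracM tofrac_eq; apply/eqP.
  by rewrite mulrAC mulrA.
have LB0 : L * B != 0 by rewrite mulf_neq0.
have mE : mob M (ratX C) = tofrac p0 / tofrac p2.
  rewrite -(frac _ _ _ _ E0 E2 LB0) !tofracM /mob -tN -tL -mulf_div.
  by rewrite divff ?mulr1 ?tofrac_eq0.
have cE' : c = tofrac p1 / tofrac p2.
  rewrite -(frac _ _ _ _ E1 E2 LB0) cE !tofracM.
  by rewrite [tofrac L * _]mulrC -mulf_div divff ?mulr1 ?tofrac_eq0.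
(* The three forms, of degree [d.+1], are the homogenizations of [p0], [y p1] and
   [p2]; as one of the three sizes is attained, [Z] is not a common factor. *)
have [d dE] : exists d, d.+1 = maxn (size p0).-1 (maxn (size p1) (size p2).-1).
  have : (0 < maxn (size p0).-1 (maxn (size p1) (size p2).-1))%N.
    by rewrite !leq_max size_poly_gt0 nz1 orbT.
  by case: (maxn _ _) => // d _; exists d.
have le_pred (u v : nat) : (u.-1 <= v -> u <= v.+1)%N by case: u.
have h0 : (size p0 <= d.+2)%N by apply: le_pred; rewrite dE leq_max leqnn.
have h1 : (size p1 <= d.+1)%N by rewrite dE !leq_max leqnn orbT.
have h2 : (size p2 <= d.+2)%N by apply: le_pred; rewrite dE !leq_max leqnn !orbT.
exists d.+1; split; last 2 first.
- rewrite dE !geq_max addn2 b1 /=; apply/andP.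
  by split; apply: leq_trans (leq_pred _) _.
- by exists p1, p2; split=> //; apply: leq_trans h1 _.
exists (fun i : 'I_3 => nth 0 [:: homogenize d.+1 p0; 'X_1 * homogenize d p1;
   homogenize d.+1 p2] i); split.
- move=> [[|[|[|//]]] hi] /=; try exact: homogenize_dhomog.
  by have := dhomogM (dhomogXi C (1 : 'I_3)) (homogenize_dhomog d p1).
- apply: no_common_factor_forms => // -[l0 l1 l2].
  have lead (p : {poly C}) l : size p = l.+1 -> p`_l = 0 -> p = 0.
    by move=> sp; rewrite -[l]/(l.+1.-1) -sp => /eqP; rewrite lead_coef_eq0 => /eqP.
  have [h|[h|h]] : size p0 = d.+2 \/ size p1 = d.+1 \/ size p2 = d.+2.
    have pS u : u.-1 = d.+1 -> u = d.+2 by case: u => //= u ->.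
    have [h|/ltnW h] := leqP (maxn (size p1) (size p2).-1) (size p0).-1.
      by left; apply: pS; rewrite dE; apply/esym/maxn_idPl.
    right; have [h'|/ltnW h'] := leqP (size p2).-1 (size p1).
      by left; rewrite dE; apply/esym; rewrite (maxn_idPr h); apply/maxn_idPl.
    by right; apply: pS; rewrite dE (maxn_idPr h); apply/esym/maxn_idPr.
  + by have z := lead _ _ h l0; rewrite z size_poly0 in h.
  + by have z := lead _ _ h l1; rewrite z size_poly0 in h.
  + by have z := lead _ _ h l2; rewrite z size_poly0 in h.
- by rewrite /= dehom_homogenize // fmorph_eq0 tofrac_eq0.
rewrite fE /jonq /= dehomM dehomX !dehom_homogenize //=.
have e2 : emb c * y = y * emb (tofrac p1) / emb (tofrac p2).
  by rewrite cE' fmorph_div mulrC mulrA.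
rewrite e2 -embX -mob_rmorph mE fmorph_div; exact: erefl.
Qed.

End JonquieresDegree.

(** * The embeddings are parabolic *)

Section Parabolic.
Variable C : numClosedFieldType.
Local Notation E := (ratfun C).

Lemma thetaX (theta : SL2Z -> bir C) : {morph theta : M N / (M * N)%g} ->
  forall M n, theta (M ^+ n)%g = (theta M ^+ n)%g.
Proof.
by move=> h M; elim=> [|n ih]; rewrite ?theta1 // !expgS h ih.
Qed.

Lemma theta_parabolic (P : E) (theta : SL2Z -> bir C) : calP P ->
  morphism_theta P theta -> parabolic_embedding theta.
Proof.
move=> cP hP; have [P0 _] := cP; have [m [zs [ps [m0 [sz sp] gp dP]]]] := calP_data cP.
have [c [c0 cE cM cS cT]] := theta_cocycle P0 hP; have [hM _ _] := hP.
split; first exact: theta_inj P0 hP.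
move=> _ [M _ <-] inf.
have infM : infinite_order M.
  by move=> n n0 E1; apply: (inf n n0); rewrite -thetaX // E1 theta1.
have [B low] := c_lower sz sp gp dP c0 cM cS cT infM.
have [a ha] := ht_le_ex (c M).
have up n := c_upper c0 cM cS n ha.
have ex n : exists d, [/\ bir_degree (theta M ^+ n)%g d,
    (d <= a * n + 2)%N & ht_le (c (M ^+ n)%g) d].
  by rewrite -thetaX //; apply: jonq_degree (c0 _) (cE _) (up n).
have [u uP] := choice ex.
exists u; split; first by move=> n; case: (uP n).
left; exists (a + 2)%N, (2 * B).+1 => n nB; have [_ u1 u2] := uP n.
have := low n _ u2; rewrite !expn1 => u3; have u4 : (n <= u n + B)%N.
  by apply: leq_trans u3; rewrite leq_pmull.
by split; nia.
Qed.

End Parabolic.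

(** * Conjugating maps preserve the pencil of vertical lines *)

Section Pencil.
Variable C : numClosedFieldType.
Local Notation E := (ratfun C).
Local Notation K := (ratfun2 C).
Local Notation x := (xvar C).
Local Notation y := (yvar C).

Lemma eval_y_neq0 (A : {poly E}) : A != 0 -> eval_y A != 0.
Proof. by apply: contra_neq => /eval_y_inj. Qed.

Lemma eval_y_frac (u : K) : exists A B : {poly E},
  [/\ B != 0, coprimep A B & u = eval_y A / eval_y B].
Proof.
have n0 := denom_ratioP (repr u); rewrite (fracE u).
rewrite -(eval_y_poly_of \n_(repr u)) -(eval_y_poly_of \d_(repr u)).
have : poly_of C \d_(repr u) != 0.
  apply: contra_neq n0 => h; apply/eqP.
  by rewrite -tofrac_eq0 -eval_y_poly_of h rmorph0.
move: (poly_of C _) (poly_of C _) => A B B0; clear n0.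
have gd : gcdp A B != 0 by rewrite gcdp_eq0 negb_and B0 orbT.
have B0' : B %/ gcdp A B != 0 by rewrite dvdp_div_eq0 // dvdp_gcdr.
exists (A %/ gcdp A B), (B %/ gcdp A B); split; first exact: B0'.
  by rewrite coprimep_div_gcd // B0 orbT.
have ng := eval_y_neq0 gd; have nB := eval_y_neq0 B0'.
have EA : eval_y A = eval_y (A %/ gcdp A B) * eval_y (gcdp A B).
  by rewrite -eval_yM divpK // dvdp_gcdl.
have EB : eval_y B = eval_y (B %/ gcdp A B) * eval_y (gcdp A B).
  by rewrite -eval_yM divpK // dvdp_gcdr.
rewrite EA EB -mulf_div (divff ng) mulr1; exact: erefl.
Qed.

Lemma eval_y_lin a b A B :
  eval_y (a%:P * A + b%:P * B) = emb a * eval_y A + emb b * eval_y B :> K.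
Proof.
apply: etrans (eval_yD _ _) _; congr (_ + _).
  exact: etrans (eval_yM _ _) (congr1 (fun z => z * eval_y A) (eval_yC a)).
exact: etrans (eval_yM _ _) (congr1 (fun z => z * eval_y B) (eval_yC b)).
Qed.

Lemma coprime_frac_eq (F : fieldType) (p q p' q' : {poly F}) :
  coprimep p q -> coprimep p' q' -> q != 0 -> p * q' = q * p' ->
  exists2 l, l != 0 & p = l *: p' /\ q = l *: q'.
Proof.
move=> cpq cpq' q0 e.
have e1 : q %= q'.
  rewrite /eqp; apply/andP; split.
    rewrite coprimep_sym in cpq; rewrite -(Gauss_dvdpr _ cpq) e dvdp_mulr //.
  by rewrite coprimep_sym in cpq'; rewrite -(Gauss_dvdpl _ cpq') -e dvdp_mull.
have [l l0 ql] := eqpf_eq _ _ e1; exists l => //; split=> //.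
have q'0 : q' != 0 by apply: contraNneq q0 => h; rewrite ql h scaler0.
by apply: (mulIf q'0); rewrite e ql -!scalerAl mulrC.
Qed.

Lemma coprime_unimodular (F : fieldType) (a b c d : F) (A B : {poly F}) :
  a * d - b * c = 1 -> coprimep A B ->
  coprimep (a%:P * A + b%:P * B) (c%:P * A + d%:P * B).
Proof.
move=> det /Bezout_eq1_coprimepP [[p q] /= h]; apply/Bezout_eq1_coprimepP.
exists (p * d%:P - q * c%:P, q * a%:P - p * b%:P) => /=.
have detP : a%:P * d%:P - b%:P * c%:P = 1 :> {poly F}.
  by rewrite -!polyCM -polyCB det.
rewrite -h -[RHS]mulr1 -detP; ring.
Qed.

Lemma expf_solve (F : fieldType) (a r c : F) (i j : nat) :
  a != 0 -> c != 0 -> (i <= j)%N -> a * c ^+ j = r * c ^+ i ->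
  c ^+ (j - i) = a^-1 * r.
Proof.
move=> a0 c0 ij E; apply: (mulIf (expf_neq0 i c0)); rewrite -exprD subnK //.
by apply: (mulfI a0); rewrite E !mulrA divff // mul1r.
Qed.

Lemma twist_coprime M (c : E) A B : coprimep A B ->
  coprimep (twist M c A) (twist M c B).
Proof.
move=> /Bezout_eq1_coprimepP [[u v] /= h]; apply/Bezout_eq1_coprimepP.
exists (twist M c u, twist M c v).
exact: etrans (esym (etrans (twistD M c (u * A) (v * B))
  (congr2 +%R (twistM M c u A) (twistM M c v B))))
  (etrans (congr1 (twist M c) h) (rmorph1 (twist M c))).
Qed.

Lemma at_div (f : ratmap C) r s : dominant f ->
  ratfun2_at f (r / s) = ratfun2_at f r / ratfun2_at f s.
Proof. by move=> df; apply: (fmorph_div (ratfun2_at_rmorphism df)). Qed.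

Lemma twist_neq0 M (c : E) A : c != 0 -> A != 0 -> twist M c A != 0.
Proof. by move=> c0; apply: contra_neq => /(twist_inj c0). Qed.

(** The coefficients in [y] of a numerator and a denominator of [u], in lowest
    terms, are transformed by a common factor [l]. *)
Lemma equivariant_coefs (u : K) (A B : {poly E}) N M (c : E) :
  c != 0 -> off_poles u -> coprimep A B -> B != 0 -> u = eval_y A / eval_y B ->
  ratfun2_at (jonq N c) u = mob M u ->
  exists2 l, l != 0 & forall i,
    act N A`_i * c ^+ i = l * ((ent M 0 0)%:~R * A`_i + (ent M 0 1)%:~R * B`_i) /\
    act N B`_i * c ^+ i = l * ((ent M 1 0)%:~R * A`_i + (ent M 1 1)%:~R * B`_i).
Proof.
move=> c0 offu cAB B0 uE eqv.
pose e i j : E := (ent M i j)%:~R.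
have det : e 0 0 * e 1 1 - e 0 1 * e 1 0 = 1.
  by rewrite /e -!rmorphM -rmorphB ent_det.
have nB := eval_y_neq0 B0.
have [A' [B' [cAB' evA' evB' coA coB]]] : exists A' B' : {poly E},
    [/\ coprimep A' B', eval_y A' = mnum M u * eval_y B,
        eval_y B' = mden M u * eval_y B,
        forall i, A'`_i = e 0 0 * A`_i + e 0 1 * B`_i &
        forall i, B'`_i = e 1 0 * A`_i + e 1 1 * B`_i].
  exists ((e 0 0)%:P * A + (e 0 1)%:P * B), ((e 1 0)%:P * A + (e 1 1)%:P * B).
  split; first exact: coprime_unimodular det cAB.
  + rewrite eval_y_lin !rmorph_int /mnum mulrDl -[_ * u * _]mulrA uE (divfK nB).
    exact: erefl.
  + rewrite eval_y_lin !rmorph_int /mden mulrDl -[_ * u * _]mulrA uE (divfK nB).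
    exact: erefl.
  + by move=> i; rewrite coefD !coefCM.
  + by move=> i; rewrite coefD !coefCM.
have df := @jonq_dominant C N c c0.
have [tA [tB [ctAB t0 atA atB [ctA ctB]]]] : exists tA tB : {poly E},
    [/\ coprimep tA tB, tB != 0,
        ratfun2_at (jonq N c) (eval_y A) = eval_y tA,
        ratfun2_at (jonq N c) (eval_y B) = eval_y tB &
        (forall i, tA`_i = act N A`_i * c ^+ i) /\
        (forall i, tB`_i = act N B`_i * c ^+ i)].
  exists (twist N c A), (twist N c B); split.
  + exact: twist_coprime.
  + exact: twist_neq0.
  + exact: at_eval_y.
  + exact: at_eval_y.
  + by split=> i; exact: coef_twist.
have nt := eval_y_neq0 t0.
have := eqv; rewrite {1}uE (at_div _ _ df) atA atB => h'.
have h : tA * B' = tB * A'.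
  apply/eqP; rewrite -subr_eq0; apply/eqP; apply: eval_y_inj.
  apply: etrans (rmorphB eval_y _ _) _; apply/eqP; rewrite subr_eq0; apply/eqP.
  apply: etrans (eval_yM _ _) (etrans _ (esym (eval_yM _ _))).
  rewrite evA' evB' mulrA mulrA; congr (_ * _); rewrite [RHS]mulrC.
  apply/eqP; rewrite -(eqr_div _ _ nt (offu M)) h'; exact: eqxx.
have [l l0 [lA lB]] := coprime_frac_eq ctAB cAB' t0 h.
exists l => // i; rewrite -ctA -ctB -/(e 0 0) -/(e 0 1) -/(e 1 0) -/(e 1 1).
by rewrite -coA -coB lA lB !coefZ.
Qed.

Lemma int_ratC (z : int) : z%:~R = ratC z%:~R :> E.
Proof. by rewrite rmorph_int. Qed.

(** Along a sequence of Jonquieres maps of unbounded height, a rational function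
    on which they act by Moebius transformations does not depend on [y]: the
    ratio of two coefficients of distinct degrees in [y] would be multiplied by
    a power of [c n], but has bounded height. *)
Lemma equivariant_vertical (u : K) (N M : nat -> SL2Z) (c : nat -> E) :
  (forall n, c n != 0) -> off_poles u ->
  (forall n, ratfun2_at (jonq (N n) (c n)) u = mob (M n) u) ->
  (forall B, exists n, ~ ht_le (c n) B) -> exists h, u = emb h.
Proof.
move=> c0 offu eqv unb; have [A [B [B0 cAB uE]]] := eval_y_frac u.
pose lin n (i : nat) (row : bool) : E := if row
  then (ent (M n) 1 0)%:~R * A`_i + (ent (M n) 1 1)%:~R * B`_i
  else (ent (M n) 0 0)%:~R * A`_i + (ent (M n) 0 1)%:~R * B`_i.
pose co (i : nat) (row : bool) : E := if row then B`_i else A`_i.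
have key n : exists2 l, l != 0 & forall i row,
    act (N n) (co i row) * c n ^+ i = l * lin n i row.
  have [l l0 h] := equivariant_coefs (c0 n) offu cAB B0 uE (eqv n).
  by exists l => // i row; have [h1 h2] := h i; case: row.
have htlin i : exists H, forall n row, ht_le (lin n i row) H.
  have [a ha] := ht_le_ex A`_i; have [b hb] := ht_le_ex B`_i.
  exists (0 + a + (0 + b))%N => n row; rewrite /lin !int_ratC.
  by case: row; apply: ht_leD; apply: ht_leM => //; apply: ht_leC.
have one i j row row' : (i < j)%N -> co i row != 0 -> co j row' != 0 -> False.
  move=> ij ni nj; have [Hi hi] := htlin i; have [Hj hj] := htlin j.
  have [a ha] := ht_le_ex (co i row); have [b hb] := ht_le_ex (co j row').
  have [n] := unb (Hj + a + (b + Hi))%N; apply.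
  have [l l0 hl] := key n; have Ei := hl i row; have Ej := hl j row'.
  have ni' := act_neq0 (N n) ni; have nj' := act_neq0 (N n) nj.
  have nli : lin n i row != 0.
    apply: contraTneq isT => z; move/eqP: Ei; rewrite z mulr0 mulf_eq0 (negPf ni').
    by rewrite expf_eq0 (negPf (c0 n)) andbF.
  have ci : c n ^+ i != 0 := expf_neq0 i (c0 n).
  have E : c n ^+ (j - i).-1.+1 = (lin n j row' * act (N n) (co i row)) /
      (act (N n) (co j row') * lin n i row).
    rewrite prednK ?subn_gt0 //; apply: (canRL (mulfK (mulf_neq0 nj' nli))).
    apply: (mulIf (mulf_neq0 ci l0)).
    have cj : c n ^+ j = c n ^+ (j - i) * c n ^+ i by rewrite -exprD subnK // ltnW.
    transitivity ((act (N n) (co j row') * c n ^+ j) * (l * lin n i row)).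
      by rewrite cj; ring.
    by rewrite Ej -Ei; ring.
  apply: (ht_le_root (m := (j - i).-1)); rewrite E.
  by apply: ht_leM; [|apply: ht_leV]; apply: ht_leM => //; apply: ht_le_act.
have [i iB] : exists i, B`_i != 0.
  by exists (size B).-1; rewrite -/(lead_coef B) lead_coef_eq0.
have zero j row : j != i -> co j row = 0.
  move=> ji; apply/eqP; apply: contraT => nj.
  have [lt|lt|E] := ltngtP j i; last by rewrite E eqxx in ji.
    by case: (one j i row true lt nj iB).
  by case: (one i j true row lt iB nj).
exists (A`_i / B`_i).
have mono (D : {poly E}) : (forall j, j != i -> D`_j = 0) ->
    eval_y D = emb D`_i * eval_y 'X^i.
  move=> D0; have {1}-> : D = (D`_i)%:P * 'X^i.
    apply/polyP => j; rewrite coefCM coefXn; have [->|ji] := eqVneq j i.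
      by rewrite mulr1.
    by rewrite mulr0 D0.
  exact: etrans (eval_yM _ _) (congr1 (fun z => z * _) (eval_yC _)).
have nX : eval_y 'X^i != 0 :> K by apply: eval_y_neq0; rewrite -size_poly_eq0 size_polyXn.
rewrite uE (mono A) => [|j ji]; last exact: (zero j false).
rewrite (mono B) => [|j ji]; last exact: (zero j true).
rewrite -mulf_div (divff nX) mulr1 fmorph_div; exact: erefl.
Qed.

(** In the same way, an eigenvector of these maps has eigenvalues that are
    either bounded, or comparable to a nonzero power of [c n]. *)
Lemma eigen_height (v : K) (N : nat -> SL2Z) (c a : nat -> E) :
  (forall n, c n != 0) -> (forall n, a n != 0) -> v != 0 ->
  (forall n, ratfun2_at (jonq (N n) (c n)) v = emb (a n) * v) ->
  exists H, (forall n, ht_le (a n) H) \/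
    (forall n k, ht_le (a n) k -> ht_le (c n) (k + H)).
Proof.
move=> c0 a0 v0 eig; have [A [B [B0 cAB vE]]] := eval_y_frac v.
have A0 : A != 0.
  by apply: contraNneq v0 => A0; rewrite vE A0 (rmorph0 eval_y) mul0r.
have key n : exists2 l, l != 0 & forall i,
    act (N n) A`_i * c n ^+ i = l * (a n * A`_i) /\
    act (N n) B`_i * c n ^+ i = l * B`_i.
  have df := @jonq_dominant C (N n) (c n) (c0 n).
  have t0 := twist_neq0 (N n) (c0 n) B0; have nt := eval_y_neq0 t0.
  have nB := eval_y_neq0 B0.
  have h' := eig n; rewrite {1}vE (at_div _ _ df) !(at_eval_y _ _ (c0 n)) in h'.
  have caAB : coprimep (a n *: A) B by rewrite coprimepZl.
  have h : twist (N n) (c n) A * B = twist (N n) (c n) B * (a n *: A).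
    apply/eqP; rewrite -subr_eq0; apply/eqP; apply: eval_y_inj.
    apply: etrans (rmorphB eval_y _ _) _; apply/eqP; rewrite subr_eq0; apply/eqP.
    apply: etrans (eval_yM _ _) (etrans _ (esym (eval_yM _ _))).
    have -> : eval_y (a n *: A) = emb (a n) * eval_y A.
      rewrite -mul_polyC.
      exact: etrans (eval_yM _ _) (congr1 (fun z => z * _) (eval_yC _)).
    rewrite vE mulrA in h'; rewrite [RHS]mulrC; apply/eqP.
    rewrite -(eqr_div _ _ nt nB) h'; exact: eqxx.
  have [l l0 [lA lB]] := coprime_frac_eq (twist_coprime (N n) (c n) cAB) caAB t0 h.
  exists l => // i; rewrite -!coef_twist; split.
    by have := congr1 (fun p : {poly E} => p`_i) lA; rewrite !coefZ.
  by have := congr1 (fun p : {poly E} => p`_i) lB; rewrite coefZ.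
have [i iA] : exists i, A`_i != 0.
  by exists (size A).-1; rewrite -/(lead_coef A) lead_coef_eq0.
have [j jB] : exists j, B`_j != 0.
  by exists (size B).-1; rewrite -/(lead_coef B) lead_coef_eq0.
have [p hp] := ht_le_ex A`_i; have [q hq] := ht_le_ex B`_j.
pose r n := (act (N n) A`_i * B`_j) / (A`_i * act (N n) B`_j).
have r0 n : r n != 0 := mulf_neq0 (mulf_neq0 (act_neq0 (N n) iA) jB)
  (invr_neq0 (mulf_neq0 iA (act_neq0 (N n) jB))).
have hr n : ht_le (r n) (p + q + (p + q)).
  by apply: ht_leM; [|apply: ht_leV]; apply: ht_leM => //; apply: ht_le_act.
have E n : a n * c n ^+ j = r n * c n ^+ i.
  have [l l0 hl] := key n; have [Ei _] := hl i; have [_ Ej] := hl j.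
  have nj := act_neq0 (N n) jB.
  apply: (mulIf (mulf_neq0 (mulf_neq0 l0 iA) jB)).
  transitivity ((l * (a n * A`_i)) * c n ^+ j * B`_j); first by ring.
  rewrite -Ei; apply: (mulIf (mulf_neq0 iA nj)).
  have -> : r n * c n ^+ i * (l * A`_i * B`_j) * (A`_i * act (N n) B`_j) =
      (act (N n) A`_i * B`_j) * (l * B`_j) * A`_i * c n ^+ i.
    rewrite /r; move: (act _ _) (act _ _) nj => w1 w2 nj.
    rewrite -[RHS](divfK (mulf_neq0 iA nj)); congr (_ * _); ring.
  by rewrite -Ej; ring.
have root n k (m : nat) : ht_le (c n ^+ m.+1) k -> ht_le (c n) k by exact: ht_le_root.
exists (p + q + (p + q))%N.
have [ij|ij|ij] := ltngtP i j.
- right=> n k hk; apply: (root n _ (j - i).-1); rewrite prednK ?subn_gt0 //.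
  rewrite (expf_solve (a0 n) (c0 n) (ltnW ij) (E n)).
  by apply: ht_leM => //; apply: ht_leV.
- right=> n k hk; apply: (root n _ (i - j).-1); rewrite prednK ?subn_gt0 //.
  rewrite (expf_solve (r0 n) (c0 n) (ltnW ij) (esym (E n))) mulrC.
  by apply: ht_leM => //; apply: ht_leV.
left=> n; have E' := E n; rewrite ij in E'.
by rewrite (mulIf (expf_neq0 j (c0 n)) E').
Qed.

End Pencil.

(** * Invertible substitutions have height one *)

Section Inverse.
Variable C : numClosedFieldType.
Local Notation E := (ratfun C).
Local Notation K := (ratfun2 C).
Local Notation x := (xvar C).
Local Notation y := (yvar C).

Lemma hom_eval_last k (N D p : {poly C}) : exists w,
  hom_eval k N D p = (p`_k)%:P * N ^+ k + D * w.
Proof.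
exists (\sum_(i < k) p`_i *: (N ^+ i * D ^+ (k - i).-1)).
rewrite /hom_eval big_ord_recr /= subnn expr0 mulr1 addrC -mul_polyC; congr (_ + _).
rewrite big_distrr /=; apply: eq_bigr => i _.
have -> : D ^+ (k - i) = D * D ^+ (k - i).-1 by rewrite -exprS prednK ?subn_gt0.
by rewrite -!mul_polyC; move: (_ ^+ (k - i).-1) (N ^+ i) => u v; ring.
Qed.

Lemma hom_eval_first k (N D p : {poly C}) : exists w,
  hom_eval k N D p = (p`_0)%:P * D ^+ k + N * w.
Proof.
exists (\sum_(i < k) p`_i.+1 *: (N ^+ i * D ^+ (k - i.+1))).
rewrite /hom_eval big_ord_recl /= expr0 mul1r subn0 -mul_polyC; congr (_ + _).
rewrite big_distrr /=; apply: eq_bigr => i _.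
rewrite /bump /= add1n exprS -!mul_polyC.
by move: (_ ^+ (k - i.+1)) (N ^+ i) => u v; ring.
Qed.

(** If [h' (A / B) = X] in lowest terms, clearing denominators shows that [A]
    and [B] divide nonzero polynomials of degree at most one. *)
Lemma inverse_ht1 (h h' : E) : transcendental_over (@ratC C) h ->
  rat_eval (@ratC C) h h' = ratX C -> ht_le h 1.
Proof.
move=> h_tr; have [A [B [B0 cAB hE]]] := ratfun_coprime h.
have [a [b [b0 cab ->]]] := ratfun_coprime h'; rewrite rat_eval_frac //.
have [D dE] : exists D, D.+1 = maxn (size a) (size b).
  have : (0 < maxn (size a) (size b))%N by rewrite leq_max [(0 < size b)%N]size_poly_gt0 b0 orbT.
  by case: (maxn _ _) => // D _; exists D.
have sa : (size a <= D.+1)%N by rewrite dE leq_maxl.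
have sb : (size b <= D.+1)%N by rewrite dE leq_maxr.
have nb := h_tr _ b0; move=> /(canRL (mulfVK nb)).
rewrite hE (hom_evalE _ B0 sa) (hom_evalE _ B0 sb) mulrA.
have BD : (tofrac B ^+ D)^-1 != 0 by rewrite invr_neq0 ?expf_neq0 ?tofrac_eq0.
move/(mulIf BD)/eqP; rewrite -tofracM tofrac_eq => /eqP eq_hom.
pose l i : {poly C} := (a`_i)%:P - 'X * (b`_i)%:P.
have sl i : (size (l i) <= 2)%N.
  rewrite /l -mulrN -polyCN mulrC addrC size_MXaddC; case: ifP => // _.
  by rewrite size_polyC; case: (_ != 0).
have l0 i : a`_i != 0 \/ b`_i != 0 -> l i != 0.
  move=> h0; apply/eqP => z.
  have := congr1 (fun p : {poly C} => p`_0) z; have := congr1 (fun p : {poly C} => p`_1) z.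
  rewrite /l !(coefB, coefXM, coefC) /= sub0r subr0 ?coef0 => /eqP.
  by rewrite oppr_eq0 => /eqP bi ai; case: h0; rewrite ?ai ?bi eqxx.
have top : l D != 0.
  apply: l0; have lead (p : {poly C}) : p != 0 -> size p = D.+1 -> p`_D != 0.
    by move=> p0 sp; rewrite -[D]/(D.+1.-1) -sp -/(lead_coef p) lead_coef_eq0.
  have [lt|ge] := ltnP (size a) (size b).
    by right; apply: lead => //; rewrite dE; apply/esym/maxn_idPr/ltnW.
  left; have sD : size a = D.+1 by rewrite dE; apply/esym/maxn_idPl.
  by apply: lead => //; rewrite -size_poly_eq0 sD.
have bot : l 0%N != 0.
  apply: l0; have [ra|] := boolP (root a 0).
    by right; rewrite -horner_coef0; apply: coprimep_root cab ra.
  by left; rewrite -horner_coef0.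
have dB : B %| l D.
  have [w wE] := hom_eval_last D A B a; have [w' wE'] := hom_eval_last D A B b.
  have cBA : coprimep B (A ^+ D) by rewrite coprimep_sym coprimep_expl.
  rewrite -(Gauss_dvdpl _ cBA) (_ : l D * A ^+ D = B * ('X * w' - w)) ?dvdp_mulr //.
  by move: eq_hom; rewrite wE wE' /l => /eqP; rewrite -subr_eq0 => /eqP z; apply/eqP;
    rewrite -subr_eq0 -z; apply/eqP; ring.
have dA : A %| l 0%N.
  have [w wE] := hom_eval_first D A B a; have [w' wE'] := hom_eval_first D A B b.
  have cBA : coprimep A (B ^+ D) by rewrite coprimep_sym coprimep_expl // coprimep_sym.
  rewrite -(Gauss_dvdpl _ cBA) (_ : l 0%N * B ^+ D = A * ('X * w' - w)) ?dvdp_mulr //.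
  by move: eq_hom; rewrite wE wE' /l => /eqP; rewrite -subr_eq0 => /eqP z; apply/eqP;
    rewrite -subr_eq0 -z; apply/eqP; ring.
exists A, B; split=> //.
  exact: leq_trans (dvdp_leq bot dA) (sl _).
exact: leq_trans (dvdp_leq top dB) (sl _).
Qed.

Lemma emb_rat_eval (h r : E) : transcendental_over (@ratC C) h ->
  rat_eval (@cst C) (emb h) r = emb (rat_eval (@ratC C) h r).
Proof.
move=> h_tr; have tr : transcendental_over (@cst C) (emb h).
  move=> p p0; have -> : (map_poly (@cst C) p).[emb h] = emb (map_poly (@ratC C) p).[h].
    rewrite -horner_map -map_poly_comp; congr (_.[_]).
    by apply: eq_map_poly => c; exact/esym/embC.
  by rewrite fmorph_eq0 h_tr.
apply/esym; rewrite -[LHS]/((emb \o rat_eval_rmorphism h_tr) r).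
apply: (rat_eval_unique tr (f := emb \o rat_eval_rmorphism h_tr)) => [c|].
  exact: etrans (congr1 emb (rat_evalC h_tr c)) (embC c).
exact: (congr1 emb (rat_evalX h_tr)).
Qed.

Lemma rat_evalK (h h' r : E) : transcendental_over (@ratC C) h ->
  transcendental_over (@ratC C) h' -> rat_eval (@ratC C) h' h = ratX C ->
  rat_eval (@ratC C) h' (rat_eval (@ratC C) h r) = r.
Proof.
move=> h_tr h_tr' hh.
rewrite -[LHS]/((rat_eval_rmorphism h_tr' \o rat_eval_rmorphism h_tr) r).
rewrite -[RHS]/((idfun : {rmorphism E -> E}) r).
apply: ratfun_morph_ext => [c|]; rewrite -[RHS]/(id _)
  -[LHS]/(rat_eval (@ratC C) h' (rat_eval (@ratC C) h _)).
  by rewrite !rat_evalC.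
by rewrite rat_evalX.
Qed.

End Inverse.

(** * Conjugate subgroups *)

Section Conjugacy.
Variable C : numClosedFieldType.
Local Notation E := (ratfun C).
Local Notation K := (ratfun2 C).
Local Notation x := (xvar C).
Local Notation y := (yvar C).

Lemma infinite_orderR : infinite_order SL2Z_R.
Proof.
move=> n n0 Rn; have : ent (SL2Z_R ^+ n)%g 0 1 = n%:Z /\ ent (SL2Z_R ^+ n)%g 1 1 = 1.
  elim: n {n0 Rn} => [|n [ih1 ih2]]; first by rewrite expg0 !ent1.
  by rewrite expgS !entM ih1 ih2 !entR; split; lia.
by rewrite Rn ent1 => -[[] n00 _]; rewrite -n00 in n0.
Qed.

Lemma pencil_of_conj (G : bir C) (M N : nat -> SL2Z) (a c : nat -> E) :
  (forall n, c n != 0) ->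
  (forall n, ratmap_comp (jonq (M n) (a n)) (bir_map G) =
             ratmap_comp (bir_map G) (jonq (N n) (c n))) ->
  (forall B, exists n, ~ ht_le (c n) B) ->
  exists2 h, (bir_map G).1 = emb h & transcendental_over (@ratC C) h.
Proof.
move=> c0 conj unb; have dG := @bir_map_dominant _ G.
have nc := dominant_nonconst dG.
have offu : off_poles (bir_map G).1 by exact: off_poles_nonconst nc.
have eqv n : ratfun2_at (jonq (N n) (c n)) (bir_map G).1 = mob (M n) (bir_map G).1.
  have := congr1 fst (conj n); rewrite /ratmap_comp /= => <-.
  by rewrite (at_mob _ _ dG) (at_x dG).
have [h hE] := equivariant_vertical c0 offu eqv unb.
exists h => //; apply: transcendental_of_nonconst => b.
by apply: contra_neq (nc b) => bh; rewrite hE -bh embC.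
Qed.

Section TwoMorphisms.
Variables (P Q : E) (zsP psP zsQ psQ : seq C) (mP mQ : nat)
  (thP thQ : SL2Z -> bir C).
Hypotheses (hP : morphism_theta P thP) (hQ : morphism_theta Q thQ)
  (P0 : P != 0) (Q0 : Q != 0) (mP0 : (0 < mP)%N) (mQ0 : (0 < mQ)%N)
  (szP : size zsP = mP) (spP : size psP = mP) (szQ : size zsQ = mQ)
  (spQ : size psQ = mQ) (gpP : general_position (zsP ++ psP))
  (gpQ : general_position (zsQ ++ psQ)) (dP : has_div P zsP psP)
  (dQ : has_div Q zsQ psQ).

(** The height of [c^P] on [R^n] is at most [2 mP n], while that of [c^Q] on
    [N^n] is at least [mQ n - O(1)]; up to bounded heights, conjugation turns the
    former into a nonzero power of the latter. *)
Lemma conj_bound (g : bir C) N : (thP SL2Z_R ^ g = thQ N)%g -> (mQ <= 2 * mP)%N.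
Proof.
move=> conj; have [a [a0 aE aM aS aT]] := theta_cocycle P0 hP.
have [c [c0 cE cM cS cT]] := theta_cocycle Q0 hQ.
have [mphP _ _] := hP; have [mphQ _ _] := hQ.
have conjX n : (thP (SL2Z_R ^+ n) * g = g * thQ (N ^+ n))%g.
  by rewrite !thetaX // -conj -conjXg /conjg mulVKg.
have infN : infinite_order N.
  move=> n n0 Nn; apply: (infinite_orderR n0); apply: (theta_inj P0 hP).
  have := conjX n; rewrite Nn (theta1 mphQ) mulg1 => e.
  by apply: (mulIg g); rewrite e (theta1 mphP) mul1g.
have [BP lowP] := c_lower szP spP gpP dP a0 aM aS aT infinite_orderR.
have [BQ lowQ] := c_lower szQ spQ gpQ dQ c0 cM cS cT infN.
have unb (m B' : nat) (b : nat -> E) : (0 < m)%N ->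
    (forall n k, ht_le (b n) k -> (m * n <= k + B')%N) ->
    forall B, exists n, ~ ht_le (b n) B.
  move=> m0 low B; exists (B + B').+1 => /low.
  by rewrite leqNgt leq_pmull.
have rel n : ratmap_comp (jonq (SL2Z_R ^+ n)%g (a (SL2Z_R ^+ n)%g)) (bir_map g) =
    ratmap_comp (bir_map g) (jonq (N ^+ n)%g (c (N ^+ n)%g)).
  by rewrite -aE -cE -!bir_mapM conjX.
have rel' n : ratmap_comp (jonq (N ^+ n)%g (c (N ^+ n)%g)) (bir_map g^-1%g) =
    ratmap_comp (bir_map g^-1%g) (jonq (SL2Z_R ^+ n)%g (a (SL2Z_R ^+ n)%g)).
  rewrite -aE -cE -!bir_mapM; congr bir_map; apply: (mulgI g); apply: (mulIg g).
  by rewrite mulgA -conjX mulgK !mulgA mulgV mul1g.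
have [h gE h_tr] := pencil_of_conj (fun n => c0 _) rel (unb _ _ _ mQ0 lowQ).
have [h' gE' h_tr'] := pencil_of_conj (fun n => a0 _) rel' (unb _ _ _ mP0 lowP).
have dg := @bir_map_dominant _ g; have dg' := @bir_map_dominant _ g^-1%g.
have hh' : rat_eval (@ratC C) h' h = ratX C.
  have := congr1 (fun f => (bir_map f).1) (mulgV g); rewrite bir_mapM /=.
  rewrite gE (at_emb _ dg') gE' (emb_rat_eval _ h_tr') -[RHS]embX.
  exact: fmorph_inj.
have h'h : rat_eval (@ratC C) h h' = ratX C.
  have := congr1 (fun f => (bir_map f).1) (mulVg g); rewrite bir_mapM /=.
  rewrite gE' (at_emb _ dg) gE (emb_rat_eval _ h_tr) -[RHS]embX.
  exact: fmorph_inj.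
have h1 := inverse_ht1 h_tr h'h; have h1' := inverse_ht1 h_tr' hh'.
pose b n := rat_eval (@ratC C) h (a (SL2Z_R ^+ n)%g).
have b0 n : b n != 0.
  rewrite -[b n]/(rat_eval_rmorphism h_tr _) fmorph_eq0; exact: a0.
have v0 : (bir_map g).2 != 0.
  apply: contraTneq isT => v0; have /dg/eqP : mpoly_at (bir_map g) 'X_1 = 0.
    by rewrite mpoly_atX.
  by rewrite -mpolyC0 (negPf (mpolyX_neqC _ _)).
have eig n : ratfun2_at (jonq (N ^+ n)%g (c (N ^+ n)%g)) (bir_map g).2 =
    emb (b n) * (bir_map g).2.
  have := congr1 snd (rel n); rewrite /ratmap_comp /= => <-.
  by rewrite (at_mul _ _ dg) (at_y dg) (at_emb _ dg) gE (emb_rat_eval _ h_tr).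
have [H [bdd|pow]] := eigen_height (fun n => c0 _) b0 v0 eig.
  have [n []] := unb _ _ _ mP0 lowP H.
  rewrite -(rat_evalK (a (SL2Z_R ^+ n)%g) h_tr h_tr' hh').
  exact: ht_le_eval h_tr' h1' (bdd n).
have up n : (mQ * n <= 2 * mP * n + (H + BQ))%N.
  have hR := ht_cR szP spP gpP dP a0 aM aS aT.
  have hn : ht_le (b n) (2 * mP * n).
    exact: ht_le_eval h_tr h1 (c_upper a0 aM aS n hR).
  by rewrite addnA; apply: lowQ; apply: pow hn.
rewrite leqNgt; apply/negP => lt; have := up (H + BQ).+1.
by rewrite leqNgt => /negP; apply; nia.
Qed.

End TwoMorphisms.
End Conjugacy.

(** * Admissible functions with many zeros *)

Section Example.
Variable C : numClosedFieldType.
Local Notation E := (ratfun C).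

(** For [k >= 2] the points [k i] are interior to the classical fundamental
    domain of the modular group. *)
Definition ipoint (k : nat) : C := 'i * k.+2%:R.

Lemma ipoint_inj : injective ipoint.
Proof.
move=> k l /(mulfI (neq0Ci C))/eqP; rewrite eqr_nat => /eqP []; exact.
Qed.

Lemma int_i_free (a b : int) : a%:~R + b%:~R * 'i = 0 :> C -> a = 0 /\ b = 0.
Proof.
move=> /eqP; rewrite addr_eq0 => /eqP /(congr1 (fun z => z ^+ 2)).
rewrite sqrrN exprMn sqrCi mulrN1 => h.
have : (a ^+ 2 + b ^+ 2)%:~R = 0 :> C.
  by rewrite rmorphD !rmorphXn /= h addNr.
by move/eqP; rewrite intr_eq0 => /eqP; split; nia.
Qed.

Lemma ipoint_orbit k l M : moebius M (Some (ipoint k)) = Some (ipoint l) ->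
  k = l /\ (M = 1%g \/ M = SL2Z_N1).
Proof.
rewrite /moebius -!/(ent M _ _); case: ifP => // /negbT nz [] /(canRL (divfK nz)).
move: nz => _; rewrite /ipoint.
set a := ent M 0 0; set b := ent M 0 1; set c := ent M 1 0; set d := ent M 1 1.
move=> h.
have /int_i_free [e1 e2] : (b + c * (k.+2%:Z * l.+2%:Z))%:~R +
    (a * k.+2%:Z - d * l.+2%:Z)%:~R * 'i = 0 :> C.
  rewrite !(rmorphD, rmorphM, rmorphN, rmorphB) /= -!pmulrn.
  have i2 := sqrCi C; move: h i2; rewrite expr2.
  move: 'i (k.+2%:R : C) (l.+2%:R : C) (a%:~R : C) (b%:~R : C) (c%:~R : C) (d%:~R : C).
  move=> i u v a' b' c' d' h i2.
  transitivity (a' * (i * u) + b' - i * v * (c' * (i * u) + d') +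
     (i * i + 1) * (c' * u * v)); first by ring.
  by rewrite h i2; ring.
have := ent_det M; rewrite -/a -/b -/c -/d => det.
have c0 : c = 0.
  have [u2 v2] : 2 <= k.+2%:Z /\ 2 <= l.+2%:Z by [].
  move: u2 v2 e1 e2; move: (k.+2%:Z) (l.+2%:Z) => u v u2 v2 e1 e2.
  have adv : (a * d) * v = a * a * u by rewrite -[LHS]mulrA (_ : d * v = a * u) ?mulrA //; lia.
  have ad0 : 0 <= a * d.
    have v0 : 0 < v by lia.
    by rewrite -(pmulr_lge0 _ v0) adv -expr2 mulr_ge0 ?sqr_ge0 //; lia.
  have uv : 4 <= u * v by nia.
  have bE : b = - (c * (u * v)) by lia.
  have : a * d + c * c * (u * v) = 1 by rewrite -det bE; ring.
  by move: (a * d) ad0 (u * v) uv => w w0 z z4 E; nia.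
have b0 : b = 0 by move: e1; rewrite c0; lia.
rewrite c0 mulr0 subr0 in det.
have [a1|a1] : a = 1 \/ a = -1.
  have : absz (a * d) = 1%N by rewrite det.
  by rewrite abszM => /eqP; rewrite muln_eq1 => /andP[/eqP]; lia.
- have d1 : d = 1 by move: det; rewrite a1; lia.
  split; first by move: e2; rewrite a1 d1; lia.
  by left; apply: SL2Z_eqE; rewrite ent1.
- have d1 : d = -1 by move: det; rewrite a1; lia.
  split; first by move: e2; rewrite a1 d1; lia.
  by right; apply: SL2Z_eqE; rewrite entN1.
Qed.

Definition izeros (m : nat) : seq C := [seq ipoint k | k <- iota 0 m].
Definition ipoles (m : nat) : seq C := [seq ipoint k | k <- iota m m].
Definition iratfun (m : nat) : E :=
  tofrac (prodX (izeros m)) / tofrac (prodX (ipoles m)).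

Lemma iratfun_div m : has_div (iratfun m) (izeros m) (ipoles m).
Proof. by exists 1; rewrite ?oner_neq0 // rmorph1 mul1r. Qed.

Lemma uniq_ipoles_zeros m : uniq (ipoles m ++ izeros m).
Proof.
rewrite -map_cat map_inj_uniq; last exact: ipoint_inj.
by rewrite uniq_catC -iotaD iota_uniq.
Qed.

Lemma calP_iratfun m : (0 < m)%N -> calP (iratfun m).
Proof.
move=> m0; split.
  by rewrite mulf_neq0 ?invr_eq0 // tofrac_eq0 prodX_neq0.
have sp : size (ipoles m) == m by rewrite size_map size_iota.
have sz : size (izeros m) == m by rewrite size_map size_iota.
exists m, (Tuple sp), (Tuple sz).
have us := uniq_ipoles_zeros m.
have /and3P[up hpz uz] : [&& uniq (ipoles m), ~~ has (mem (ipoles m)) (izeros m) &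
  uniq (izeros m)] by rewrite -cat_uniq.
have ordE a : ratfun_ord (iratfun m) (Some a) =
    (a \in izeros m)%:Z - (a \in ipoles m)%:Z.
  by rewrite ratfun_ord_Some ?prodX_neq0 // !mup_prodX !count_uniq_mem.
have im a : a \in ipoles m ++ izeros m -> exists k, a = ipoint k.
  by rewrite -map_cat => /mapP[k _ ->]; exists k.
split=> //.
- move=> a ap; rewrite ordE ap; have /negPf -> // : a \notin izeros m.
  by apply: contraL ap => /(hasPn hpz).
- move=> a az; rewrite ordE az; have /negPf -> // : a \notin ipoles m := hasPn hpz a az.
- move=> [a|] nz; last first.
    by rewrite ratfun_ord_None ?prodX_neq0 // !size_prod_XsubC (eqP sp) (eqP sz) subrr.
  rewrite ordE; have : a \notin ipoles m ++ izeros m.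
    by apply: contra nz => ha; apply/mapP; exists a.
  by rewrite mem_cat negb_or => /andP[/negPf -> /negPf ->].
split.
  move=> a b /im[k ->] /im[l ->] kl [M] /ipoint_orbit [E _].
  by rewrite E eqxx in kl.
by move=> a /im[k ->] M /ipoint_orbit [].
Qed.

Lemma iratfun_general m : general_position (izeros m ++ ipoles m).
Proof.
have im a : a \in izeros m ++ ipoles m -> exists k, a = ipoint k.
  by rewrite -map_cat => /mapP[k _ ->]; exists k.
have off k : off_poles (ipoint k).
  by apply: no_isotropy_off_poles => M /ipoint_orbit [].
split; first by rewrite uniq_catC uniq_ipoles_zeros.
  by move=> a /im[k ->].
move=> a b /im[k ->] /im[l ->] M E.
have : moebius M (Some (ipoint k)) = Some (ipoint l) by rewrite moebius_Some ?off // E.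
by case/ipoint_orbit => ->.
Qed.

End Example.

Local Open Scope classical_set_scope.

Lemma conj_class_eq (G : groupType) (H H' : set G) :
  conj_class H = conj_class H' -> exists g, forall h, H h -> H' (h ^ g)%g.
Proof.
move=> E; have : conj_class H H.
  by exists 1%g => //; rewrite eqEsubset; split=> [_ [h Hh <-]|h Hh];
     [rewrite conjg1 | exists h => //; rewrite conjg1].
rewrite E => -[g _ <-]; exists g^-1%g => _ [h Hh <-].
by rewrite conjgK.
Qed.

Theorem proposition3p9 (R : realType) :
  [/\ (forall P : ratfun R[i], calP P ->
         exists! theta : SL2Z -> bir R[i], morphism_theta P theta),
      (forall (P : ratfun R[i]) (theta : SL2Z -> bir R[i]),
         calP P -> morphism_theta P theta -> parabolic_embedding theta)
    & infinite_set
        [set conj_class (range theta)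
           | theta in [set theta : SL2Z -> bir R[i] |
               exists2 P : ratfun R[i], calP P & morphism_theta P theta]]%classic].
Proof.
split=> [P [P0 _]|P theta|]; first exact: theta_exists_unique.
  exact: theta_parabolic.
pose P j : ratfun R[i] := iratfun _ (3 ^ j).
have cP j : calP (P j) by apply: calP_iratfun; rewrite expn_gt0.
have P0 j : P j != 0 by case: (cP j).
have ex j : exists th : SL2Z -> bir R[i], morphism_theta (P j) th.
  by have [th [h _]] := theta_exists_unique (P0 j); exists th.
have [th thP] := choice ex.
have lt3 i j : (i < j)%N -> conj_class (range (th i)) <> conj_class (range (th j)).
  move=> ij /conj_class_eq [g hg].
  have [N _ conj] := hg (th i SL2Z_R) (ex_intro2 _ _ SL2Z_R I erefl).
  have sz m : size (izeros R[i] m) = m by rewrite size_map size_iota.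
  have sp m : size (ipoles R[i] m) = m by rewrite size_map size_iota.
  have pos k : (0 < 3 ^ k)%N by rewrite expn_gt0.
  have := conj_bound (thP i) (thP j) (P0 i) (P0 j) (pos i) (pos j) (sz _) (sp _)
    (sz _) (sp _) (iratfun_general _ _) (iratfun_general _ _) (iratfun_div _ _)
    (iratfun_div _ _) (esym conj).
  have := leq_pexp2l (isT : 0 < 3)%N ij; rewrite expnS; have := pos i; lia.
move=> fin; apply: infinite_nat.
have -> : [set: nat] = (fun j => conj_class (range (th j))) @^-1`
    [set conj_class (range theta) | theta in [set theta : SL2Z -> bir R[i] |
       exists2 P : ratfun R[i], calP P & morphism_theta P theta]].
  by rewrite eqEsubset; split=> // j _; exists (th j) => //; exists (P j).
apply: finite_preimage fin => i j _ _ E.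
by have [/lt3|/lt3/(_ (esym E))|//] := ltngtP i j.
Qed.
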